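(* Let $X_1,X_2,\dots$ be i.i.d. from a one-parameter exponential family $f_\theta(x)=f_0(x)e^{\theta x-\psi(\theta)}$, $\theta\in\Theta$, satisfying the standing assumptions in the context, and fix $\theta_0\in\Theta$. Let $G$ be a probability distribution (prior) on $\Theta$ that is absolutely continuous with respect to Lebesgue measure, and let $(H_\gamma)_{\gamma\in\Gamma}$ be a parametric family of mixing distributions on $\Theta$ with densities $h_\gamma$ positive and continuous on $\Theta$. Let $\rho_\gamma(\theta)$ be the relative run-length profile of the truncated mSPRT $(T^{H_\gamma}(M,\alpha),\delta^{H_\gamma}(M,\alpha))$. Put $$A(M,\alpha)=\{\theta: I(\theta,\theta_0)\ge \log(1/\alpha)/M\}.$$ Then, up to $o(1)$ terms as $\alpha\to0$ with $M=O(\log(1/\alpha))$, the average relative run-length $\mathbb E_{\theta\sim G}\{\rho_\gamma(\theta)\}$ is minimized over $\gamma \in \Gamma$ by any $$\gamma^*\in\arg\min_{\gamma\in\Gamma}\ -\mathbb E_{\theta\sim G}\big[\mathbf 1_{A(M,\alpha)}(\theta)\, I(\theta,\theta_0)^{-1}\log h_\gamma(\theta)\big],$$ i.e. $\mathbb E_{\theta\sim G}\{\rho_{\gamma^*}(\theta)\}\le\mathbb E_{\theta\sim G}\{\rho_{\gamma}(\theta)\}+o(1)$ for every $\gamma\in\Gamma$. Moreover, if $h_\gamma(\theta)=q(\gamma_1,\gamma_2)e^{\gamma_1\theta-\gamma_2\psi(\theta)}$, $\gamma=(\gamma_1,\gamma_2)$, is a conjugate prior for $f_\theta$, then $\gamma^*$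 solves, with $A=A(M,\alpha)$, $$\frac{\partial q(\gamma_1,\gamma_2)/\partial\gamma_1}{\partial q(\gamma_1,\gamma_2)/\partial\gamma_2}=-\frac{\mathbb E_{\theta\sim G}[\mathbf 1_A(\theta)\,\theta\, I(\theta,\theta_0)^{-1}]}{\mathbb E_{\theta\sim G}[\mathbf 1_A(\theta)\,\psi(\theta)\, I(\theta,\theta_0)^{-1}]}.$$
   Context: Standing assumptions: the data are real valued; $\Theta\subset\mathbb R$ is an open interval; $\psi''(\theta)>0$ for all $\theta\in\Theta$; $\mathbb E_\theta|X_1|^4<\infty$. Here $I(\theta,\theta_0)=(\theta-\theta_0)\psi'(\theta)-(\psi(\theta)-\psi(\theta_0))$. mSPRT with mixing distribution $H$ for $H_0:\theta=\theta_0$ versus $H_1:\theta\ne\theta_0$: with $S_n=\frac1n\sum_{i=1}^nX_i$, $$\Lambda^H_n=\int_\Theta\Big(\tfrac{f_\theta(S_n)}{f_{\theta_0}(S_n)}\Big)^n dH(\theta)=\int_\Theta e^{n[(\theta-\theta_0)S_n-(\psi(\theta)-\psi(\theta_0))]}dH(\theta),$$ $T^H(\alpha)=\inf\{n:\Lambda_n^H\ge\alpha^{-1}\}$, $\delta^H(\alpha)=\mathbf 1\{T^H(\alpha)<\infty\}$. For a positive integer $M$, the truncated rule is $T^H(M,\alpha)=\min\{T^H(\alpha),M\}$, $\delta^H(M,\alpha)=\mathbf 1\{T^H(\alpha)\le M\}$, and its relative run-length profile is $\rho(\theta)=\mathbb E_\theta(T^H(M,\alpha))/M$. The minimizer $\gamma^*$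 may depend on $(M,\alpha)$.
   Formalization: For γ* varying with α, G is assumed to have E_G[log⁺(dG/dx)]<∞, or h_γ to be locally bounded below over the minimizers (false otherwise); the minimal criterion is finite; in the conjugate part γ* is interior to Γ, both expectations exist and the denominator is nonzero. *)

(* Defs.v *)
From HB Require Import structures.
From mathcomp Require Import all_boot all_order all_algebra.
From mathcomp Require Import all_classical all_reals all_analysis.

Set Implicit Arguments.
Unset Strict Implicit.
Unset Printing Implicit Defensive.

Import Order.TTheory GRing.Theory Num.Theory numFieldNormedType.Exports.
Local Open Scope classical_set_scope.
Local Open Scope ring_scope.

Definition mutually_independent (R : realType) (d : measure_display)
    (Omega : measurableType d) (P : probability Omega R)
    (X : nat -> {mfun Omega >-> R}) : Prop :=
  forall (J : seq nat) (B : nat -> set R), uniq J ->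
    (forall j, measurable (B j)) ->
    P (\bigcap_(j in [set` J]) (X j @^-1` B j)) =
    (\prod_(j <- J) P (X j @^-1` B j))%E.

(* The base density f0 and all the f_theta are taken with respect to a common
   sigma-finite measure mu, so discrete families are covered too. *)
Definition expfam_density (R : realType) (f0 psi : R -> R) (theta x : R) : R :=
  f0 x * expR (theta * x - psi theta).

Definition has_density (R : realType) (mu : {measure set (measurableTypeR R) -> \bar R})
    (Q : set R -> \bar R) (f : R -> R) : Prop :=
  forall B : set R, measurable B -> Q B = (\int[mu]_(x in B) (f x)%:E)%E.

(* X j stands for the (j+1)-st observation. *)
Definition iid_expfam (R : realType) (mu : {measure set (measurableTypeR R) -> \bar R})
    (f0 psi : R -> R) (Theta : set R) (d : measure_display)
    (Omega : measurableType d) (P : R -> probability Omega R)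
    (X : nat -> {mfun Omega >-> R}) : Prop :=
  forall theta, Theta theta ->
    mutually_independent (P theta) X /\
    forall j, has_density mu (distribution (P theta) (X j))
                (expfam_density f0 psi theta).

Definition info (R : realType) (psi : R -> R) (theta theta0 : R) : R :=
  (theta - theta0) * derive1 psi theta - (psi theta - psi theta0).

Section msprt.
Context (R : realType) (d : measure_display) (Omega : measurableType d).
Context (psi : R -> R) (Theta : set R) (theta0 : R).
Context (X : nat -> {mfun Omega >-> R}).
Implicit Types (H : probability (measurableTypeR R) R) (M n : nat) (alpha : R) (w : Omega).

Definition sample_mean n w : R := n%:R^-1 * \sum_(j < n) X j w.

(* The exponential form of the mixture likelihood ratio is used: it agrees with
   the ratio of densities and avoids 0 / 0 where f0 vanishes. *)
Definition mixture_lr H n w : \bar R :=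
  (\int[H]_(theta in Theta)
     (expR (n%:R * ((theta - theta0) * sample_mean n w
                    - (psi theta - psi theta0))))%:E)%E.

(* ereal_inf set0 = +oo: the test never stops. *)
Definition stop_time H alpha w : \bar R :=
  ereal_inf [set (n%:R)%:E | n in
    [set n | (0 < n)%N /\ ((alpha^-1)%:E <= mixture_lr H n w)%E]].

Definition trunc_stop_time H M alpha w : \bar R :=
  Order.min (stop_time H alpha w) (M%:R)%:E.

Definition run_length_profile (P : R -> probability Omega R) H M alpha
    (theta : R) : R :=
  fine (\int[P theta]_w trunc_stop_time H M alpha w)%E / M%:R.

Definition avg_run_length (P : R -> probability Omega R) (G : probability (measurableTypeR R) R)
    H M alpha : R :=
  Rintegral G Theta (run_length_profile P H M alpha).

Definition Aset M alpha : set R :=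
  [set theta | Theta theta /\ ln (alpha^-1) / M%:R <= info psi theta theta0].

Definition weight M alpha (theta : R) : R :=
  \1_(Aset M alpha) theta * (info psi theta theta0)^-1.

Definition criterion (G : probability (measurableTypeR R) R) (I : Type) (h : I -> R -> R)
    M alpha (g : I) : \bar R :=
  (- \int[G]_(theta in Theta) (weight M alpha theta * ln (h g theta))%:E)%E.

End msprt.

(* The minimal value has to be finite: if the criterion is +oo on the whole of
   Gamma there is nothing to minimize. *)
Definition is_argmin (R : realType) (I : Type) (Gamma : set I)
    (F : I -> \bar R) (g : I) : Prop :=
  [/\ Gamma g, F g \is a fin_num &
      forall g', Gamma g' -> (F g <= F g')%E].

Definition mixing_family (R : realType) (Theta : set R) (I : Type)
    (Gamma : set I) (h : I -> R -> R) (H : I -> probability (measurableTypeR R) R) : Prop :=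
  forall g, Gamma g ->
    [/\ forall theta, Theta theta -> 0 < h g theta,
        forall theta, Theta theta -> {for theta, continuous (h g)} &
        forall B : set R, measurable B ->
          H g B = (\int[lebesgue_measure]_(theta in B `&` Theta)
                     (h g theta)%:E)%E].

(* Automatic when K is a single point or, for a jointly continuous h, compact. *)
Definition locally_bounded_below (R : realType) (Theta : set R) (I : Type)
    (h : I -> R -> R) (K : set I) : Prop :=
  forall C : set R, compact C -> C `<=` Theta ->
    exists2 m : R, 0 < m &
      forall g theta, K g -> C theta -> m <= h g theta.

(* E_G[log^+ (dG/dx)] < oo, which makes the positive part of log h integrable
   with respect to G for every probability density h. *)
Definition finite_entropy (R : realType) (G : probability (measurableTypeR R) R) : Prop :=
  exists f : R -> R,
    [/\ measurable_fun [set: measurableTypeR R] f, forall x, 0 <= f x,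
        has_density lebesgue_measure G f &
        (\int[G]_x (Order.max 0 (ln (f x)))%:E < +oo)%E].

Definition conjugate_density (R : realType) (psi : R -> R) (q : R -> R -> R)
    (g : R * R) (theta : R) : R :=
  q g.1 g.2 * expR (g.1 * theta - g.2 * psi theta).

(* Main.v *)
(* Put L = log(1/alpha) and c = L/M.  Up to o(1) the relative run length of any
   mSPRT at theta is at least min(1, c / I(theta, theta0)), uniformly over all
   mixing distributions: the mixture likelihood ratio against theta0 is the
   likelihood ratio of theta against theta0 times a mixture ratio against theta,
   whose P_theta-mean is at most 1 by Tonelli, so it can reach 1/alpha only when
   the log-likelihood ratio of theta does, which by Chernoff does not happen
   before about L / I(theta, theta0) observations.  Conversely this bound is
   attained wherever the mixing density is not exponentially small (in L) near
   theta.  Hence every candidate is asymptotically optimal, and the only issue is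
   uniformity over minimizers that move with alpha.  When G has finite entropy
   the positive part of log h_gamma is uniformly G-integrable, so a bounded
   minimal criterion prevents h_gamma from being exponentially small except on
   a set of small G-mass; absolute continuity of G transfers this from points to
   Lebesgue-fat neighbourhoods.

   In the conjugate case 1/q is the Laplace transform of a measure, hence
   differentiable, and the criterion is affine in gamma and log q, so that gamma*
   is a critical point. *)
Require Import Defs.
From HB Require Import structures.
From mathcomp Require Import all_boot all_order all_algebra.
From mathcomp Require Import all_classical all_reals all_analysis.
From mathcomp Require Import measurable_realfun.
From mathcomp Require Import ring lra.

Set Implicit Arguments.
Unset Strict Implicit.
Unset Printing Implicit Defensive.

Import Order.TTheory GRing.Theory Num.Theory numFieldNormedType.Exports.
Local Open Scope classical_set_scope.
Local Open Scope ring_scope.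

(** * Integration *)

(** The family [P] is indexed by [theta] without any measurability, so a run-length profile is not
    known to be measurable in [theta], and two averages cannot simply be subtracted under the
    integral. Each average is compared instead with integrals of measurable functions, through a
    monotonicity of nonnegative integrals that asks for no measurability.

    Uniformity rests on the order of choices. The error fixes a segment of [Theta] carrying almost
    all of [G]; the segment fixes the Chernoff constants, a radius and an exponential rate; these
    fix a Lebesgue mass; only then is [alpha] made small. None of these choices depends on the
    mixing distribution.

    The ratio log(1/alpha)/M is bounded away from 0, but it need neither converge nor stay bounded.
    The bound on the minimal criterion must therefore hold at all such cuts at once, although
    minimizers may exist at only some of them. *)

Section measure_facts.
Context d (T : measurableType d) (R : realType).
Local Open Scope ereal_scope.
Import HBNNSimple.

(** Combines image measure and density, so that it serves both with [phi := X k] and a weight coming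
    from the other coordinates, and with [phi := id] for a plain density. Monotone convergence on
    both sides reduces it to indicators, where it is the hypothesis on [nu]. *)
Lemma ge0_integral_density_comp d' (Y : measurableType d')
    (m : {measure set T -> \bar R}) (phi : T -> Y) (g : T -> R)
    (nu : {measure set Y -> \bar R}) (f : Y -> \bar R) :
  measurable_fun [set: T] phi -> measurable_fun [set: T] g -> (forall x, 0 <= g x)%R ->
  (forall B, measurable B -> nu B = \int[m]_(x in phi @^-1` B) (g x)%:E) ->
  measurable_fun [set: Y] f -> (forall y, 0 <= f y) ->
  \int[nu]_y f y = \int[m]_x (f (phi x) * (g x)%:E).
Proof.
move=> mphi /measurable_EFinP mg g0 nuE mf f0.
pose h := nnsfun_approx measurableT mf.
have mh n : measurable_fun setT (EFin \o h n \o phi).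
  by apply: measurableT_comp => //; exact/measurable_EFinP.
have mpre B : measurable B -> measurable (phi @^-1` B).
  by move=> mB; rewrite -[X in measurable X]setTI; exact: mphi.
have -> : \int[nu]_y f y = limn (fun n => \int[nu]_y (h n y)%:E).
  rewrite -monotone_convergence//.
  - by apply: eq_integral => y _; apply/esym/cvg_lim => //; exact: cvg_nnsfun_approx.
  - by move=> n; exact/measurable_EFinP.
  - by move=> n y _; rewrite lee_fin.
  - by move=> y _ a b ab; rewrite lee_fin; exact/lefP/nd_nnsfun_approx.
have -> : \int[m]_x (f (phi x) * (g x)%:E) =
    limn (fun n => \int[m]_x ((h n (phi x))%:E * (g x)%:E)).
  rewrite -monotone_convergence//.
  - apply: eq_integral => x _; apply/esym/cvg_lim => //.
    by apply: cvgeZr => //; exact: cvg_nnsfun_approx.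
  - by move=> n; exact: (emeasurable_funM (mh n) mg).
  - by move=> n x _; rewrite mule_ge0 ?lee_fin.
  - move=> x _ a b ab; rewrite lee_wpmul2r ?lee_fin//.
    exact/lefP/nd_nnsfun_approx.
congr (limn _); apply/funext => n.
transitivity (\int[nu]_x
   (\sum_(y \in range (h n)) (y * \1_(h n @^-1` [set y]) x)%:E)).
  by apply: eq_integral => t _; rewrite /= fimfunE -fsumEFin.
rewrite ge0_integral_fsum//; last 2 first.
- by move=> y; apply/measurable_EFinP; exact: measurable_funM.
- by move=> y x _; exact: nnfun_muleindic_ge0.
transitivity (\int[m]_x (\sum_(y \in range (h n))
    (y * \1_(h n @^-1` [set y]) (phi x))%:E * (g x)%:E)); last first.
  apply: eq_integral => x _; rewrite [in RHS]fimfunE -fsumEFin//.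
  by rewrite ge0_mule_fsuml// => y; exact: nnfun_muleindic_ge0.
have mi (y : R) : measurable_fun setT
    (fun x => (y * \1_(h n @^-1` [set y]) (phi x))%:E).
  apply/measurable_EFinP; apply: measurable_funM => //.
  by apply: measurableT_comp mphi.
rewrite ge0_integral_fsum//; last 2 first.
- by move=> y; exact: emeasurable_funM.
- move=> y x _; apply: mule_ge0; last by rewrite lee_fin.
  exact: (nnfun_muleindic_ge0 (h n)).
apply: eq_fsbigr => r; rewrite inE => -[t _ <-].
rewrite integralZl_indic_nnsfun//.
under [RHS]eq_integral do rewrite EFinM -muleA.
rewrite ge0_integralZl//; last 3 first.
- apply: emeasurable_funM => //; apply/measurable_EFinP.
  by apply: measurableT_comp mphi.
- by move=> x _; rewrite mule_ge0// lee_fin.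
- by rewrite lee_fin.
congr (_ * _); rewrite integral_indic// setIT nuE// integral_mkcond.
apply: eq_integral => x _; rewrite /patch indicE.
have -> : (x \in phi @^-1` (h n @^-1` [set h n t])) = (phi x \in h n @^-1` [set h n t]).
  by apply/idP/idP; rewrite !inE.
by case: ifP; rewrite ?mul1e ?mul0e.
Qed.

(* The integral of a nonnegative function is a supremum over the simple
   functions below it, so it is monotone without any measurability. *)
Lemma ge0_le_integral_nomeas (m : {measure set T -> \bar R}) (D : set T)
    (f g : T -> \bar R) :
  (forall x, D x -> 0 <= f x) -> (forall x, D x -> f x <= g x) ->
  \int[m]_(x in D) f x <= \int[m]_(x in D) g x.
Proof.
move=> f0 fg.
have g0 x : D x -> 0 <= g x by move=> Dx; exact: le_trans (f0 _ Dx) (fg _ Dx).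
rewrite !ge0_integralE//; apply: ereal_sup_le => _ /= [h hf <-].
exists h => // x; apply: le_trans (hf x) _.
exact: lee_restrict.
Qed.

End measure_facts.

(** * Independent sums and exponential families *)

Section independent_sums.
Context (R : realType) (d : measure_display) (Omega : measurableType d).
Implicit Types (P : probability Omega R) (X : nat -> {mfun Omega >-> R}).

Lemma measurable_sum_prefix X k :
  measurable_fun [set: Omega] (fun w => \sum_(j < k) X j w).
Proof. by apply: measurable_sum => j; exact: measurable_funPT. Qed.

Lemma measurable_cylinder X (J : seq nat) (B : nat -> set R) :
  (forall j, measurable (B j)) ->
  measurable (\bigcap_(j in [set` J]) (X j @^-1` B j)).
Proof.
move=> mB; apply: bigcap_measurableType => j _.
by rewrite -[X in measurable X]setTI; exact: measurable_funPT.
Qed.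

(** Independence speaks of events only, so the induction carries a cylinder [E] over coordinates
    [>= k]. With the extra constraint that [X k] lies in [A], the induction hypothesis says that
    weighting [P] by the exponential of the first [k] terms on [E] preserves the law of [X k] up to
    the factor [m ^+ k * P E]; integrating [expR (t * x)] against that law gives one more [m]. *)
Lemma independent_sum_mgf P X (t m : R) : mutually_independent P X ->
  (forall j, (\int[P]_w (expR (t * X j w))%:E = m%:E)%E) ->
  forall k (J : seq nat) (B : nat -> set R), uniq J ->
    (forall j, measurable (B j)) -> (forall j, j \in J -> (k <= j)%N) ->
  (\int[P]_(w in \bigcap_(j in [set` J]) (X j @^-1` B j))
     (expR (t * \sum_(j < k) X j w))%:E =
   (m ^+ k)%:E * P (\bigcap_(j in [set` J]) (X j @^-1` B j)))%E.
Proof.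
move=> indep mgf.
have m0 : 0 <= m.
  by rewrite -lee_fin -(mgf 0%N); apply: integral_ge0 => w _; rewrite lee_fin expR_ge0.
elim=> [|k IH] J B uJ mB kJ.
  under eq_integral do rewrite big_ord0 mulr0 expR0.
  by rewrite integral_cst ?mul1e ?expr0 ?mul1e//; exact: measurable_cylinder.
set E := \bigcap_(j in _) _.
have mE : measurable E by exact: measurable_cylinder.
have r0 : 0 <= m ^+ k * fine (P E) by rewrite mulr_ge0 ?exprn_ge0 ?fine_ge0.
pose nu : {measure set R -> \bar R} :=
  mscale (NngNum r0) (distribution P (X k)).
have mS : measurable_fun [set: Omega] (fun w => expR (t * \sum_(j < k) X j w)).
  apply: measurableT_comp => //; apply: measurable_funM => //.
  exact: measurable_sum_prefix.
have kNJ : k \notin J by apply/negP => /kJ; rewrite ltnn.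
have nuE A : measurable A -> (nu A = \int[P]_(w in X k @^-1` A)
    (expR (t * \sum_(j < k) X j w) * \1_E w)%:E)%E.
  (* The indices in [J] are at least [k.+1], so slot [k] is free to receive [A]. *)
  move=> mA; pose B' j := if j == k then A else B j.
  have mB' j : measurable (B' j) by rewrite /B'; case: ifP.
  have capE : \bigcap_(j in [set` J]) (X j @^-1` B' j) = E.
    apply: eq_bigcapr => j /= jJ; rewrite /B'; case: eqP => // jk.
    by move: kNJ; rewrite -jk jJ.
  have capE' : \bigcap_(j in [set` k :: J]) (X j @^-1` B' j) = X k @^-1` A `&` E.
    apply/seteqP; split => w /=.
      move=> h; split.
        by have := h k; rewrite /B' eqxx; apply; rewrite /= inE eqxx.
      by rewrite -capE => j /= jJ; apply: h; rewrite /= inE jJ orbT.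
    move=> [hk]; rewrite -capE => hE j /=; rewrite inE => /predU1P[->|jJ].
      by rewrite /B' eqxx.
    exact: hE.
  have := IH (k :: J) B'; rewrite /= kNJ uJ capE' => /(_ isT mB').
  have kk j : j \in k :: J -> (k <= j)%N.
    by rewrite inE => /predU1P[->//|/kJ/ltnW].
  move=> /(_ kk) IHk.
  transitivity (\int[P]_(w in X k @^-1` A `&` E)
      (expR (t * \sum_(j < k) X j w))%:E)%E; last first.
    rewrite integral_mkcondr; apply: eq_integral => w _.
    by rewrite epatch_indic EFinM.
  rewrite IHk -capE' indep//= ?kNJ// big_cons {1}/B' eqxx.
  rewrite -indep// capE /nu /mscale/= EFinM fineK ?fin_num_measure//.
  by rewrite -muleA; congr (_ * _)%E; rewrite muleC.
have := @ge0_integral_density_comp _ _ R _ _ P (X k)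
  (fun w => expR (t * \sum_(j < k) X j w) * \1_E w) nu
  (fun x => (expR (t * x))%:E).
move=> /(_ (@measurable_funPT _ _ _ _ (X k))) H.
have {}H := H _ _ nuE _ _.
transitivity (\int[P]_x ((expR (t * X k x))%:E *
   (expR (t * \sum_(j < k) X j x) * \1_E x)%:E))%E.
  rewrite integral_mkcond; apply: eq_integral => w _.
  rewrite epatch_indic big_ord_recr/= mulrDr expRD !EFinM.
  by rewrite muleCA muleA.
have mexp : measurable_fun [set: R] (fun x : R => (expR (t * x))%:E).
  by apply/measurable_EFinP; apply: measurableT_comp => //; exact: measurable_funM.
rewrite -H //.
- rewrite ge0_integral_mscale//= ge0_integral_distribution//=.
  by rewrite mgf exprSr !EFinM fineK ?fin_num_measure// muleAC.
- by apply: measurable_funM => //; exact: measurable_indic.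
Qed.

End independent_sums.

Section exponential_family.
Context (R : realType) (d : measure_display) (Omega : measurableType d).
Context (mu : {sigma_finite_measure set (measurableTypeR R) -> \bar R}).
Context (f0 psi : R -> R) (Theta : set R).
Context (P : R -> probability Omega R) (X : nat -> {mfun Omega >-> R}).
Context (H : probability (measurableTypeR R) R).
Hypothesis f0_meas : measurable_fun [set: measurableTypeR R] f0.
Hypothesis f0_ge0 : forall x, 0 <= f0 x.
Hypothesis Theta_open : open Theta.
Hypothesis iid : iid_expfam mu f0 psi Theta P X.
Hypothesis psi_meas : measurable_fun Theta psi.

Let mexp (a : R) : measurable_fun [set: measurableTypeR R] (fun x => expR (a * x)).
Proof. by apply: measurableT_comp => //; exact: measurable_funM. Qed.

Lemma measurable_expfam_density theta :
  measurable_fun [set: measurableTypeR R] (expfam_density f0 psi theta).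
Proof.
apply: measurable_funM => //; apply: measurableT_comp => //.
by apply: measurable_funB => //; exact: measurable_funM.
Qed.

(** Exponential tilting: the factor [expR ((theta' - theta) * x)] turns the density at [theta] into
    the one at [theta'], up to the constant [expR (psi theta' - psi theta)], and the latter density
    has total mass 1. *)
Lemma expfam_mgf theta theta' j : Theta theta -> Theta theta' ->
  (\int[P theta]_w (expR ((theta' - theta) * X j w))%:E =
   (expR (psi theta' - psi theta))%:E)%E.
Proof.
move=> Tt Tt'; have [_ dens] := iid Tt; have [_ dens'] := iid Tt'.
have mf := mexp (theta' - theta).
transitivity (\int[distribution (P theta) (X j)]_x
    (expR ((theta' - theta) * x))%:E)%E.
  rewrite ge0_integral_distribution//; exact/measurable_EFinP.
transitivity (\int[mu]_x ((expR ((theta' - theta) * x))%:E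
    * (expfam_density f0 psi theta x)%:E))%E.
  apply: (@ge0_integral_density_comp _ (measurableTypeR R) R _ R mu id
    (expfam_density f0 psi theta) (distribution (P theta) (X j))
    (fun x => (expR ((theta' - theta) * x))%:E)) => //.
  - exact: measurable_expfam_density.
  - by move=> x; rewrite mulr_ge0 ?expR_ge0.
  - exact: dens.
  - exact/measurable_EFinP.
transitivity (\int[mu]_x ((expR (psi theta' - psi theta))%:E *
    (expfam_density f0 psi theta' x)%:E))%E.
  apply: eq_integral => x _; rewrite -!EFinM /expfam_density.
  rewrite mulrCA [in RHS]mulrCA -!expRD.
  by congr (_ * expR _)%:E; ring.
rewrite ge0_integralZl//.
- have := dens' j [set: R] measurableT; rewrite probability_setT => <-.
  by rewrite mule1.
- by apply/measurable_EFinP; exact: measurable_expfam_density.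
- by move=> x _; rewrite lee_fin mulr_ge0 ?expR_ge0.
Qed.

Lemma expfam_sum_mgf theta theta' k : Theta theta -> Theta theta' ->
  (\int[P theta]_w (expR ((theta' - theta) * \sum_(j < k) X j w))%:E =
   (expR (k%:R * (psi theta' - psi theta)))%:E)%E.
Proof.
move=> Tt Tt'; have [indep _] := iid Tt.
have := @independent_sum_mgf _ _ _ (P theta) X (theta' - theta) _ indep
  (fun j => expfam_mgf j Tt Tt') k [::] (fun=> setT) erefl (fun=> measurableT).
rewrite set_nil bigcap_set0 probability_setT mule1 => -> //.
by rewrite -expRM_natl.
Qed.

Lemma natr_sample_mean k w :
  k%:R * sample_mean X k w = \sum_(j < k) X j w.
Proof.
rewrite /sample_mean; case: k => [|k]; first by rewrite mul0r big_ord0.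
by rewrite mulrA divff ?mul1r ?pnatr_eq0.
Qed.

(** [psi] is known to be measurable on [Theta] only. Restricting it and inserting the indicator of
    [Theta] gives an integrand jointly measurable on the whole product, as Tonelli requires. The
    reference point is arbitrary: [theta0] for the test, the true parameter for its tail bound. *)
Lemma mixture_lrE theta k w :
  (mixture_lr psi Theta theta X H k w =
   \int[H]_x ((expR ((x - theta) * \sum_(j < k) X j w
       - k%:R * ((psi \_ Theta) x - psi theta))) * \1_Theta x)%:E)%E.
Proof.
rewrite /mixture_lr integral_mkcond; apply: eq_integral => x _.
rewrite epatch_indic -natr_sample_mean /patch /= indicE.
case: (x \in Theta); rewrite ?mulr0 ?mule0// mulr1 mule1.
by congr (expR _)%:E; ring.
Qed.

Let mJ theta k : measurable_fun [set: Omega * measurableTypeR R]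
  (fun z : Omega * measurableTypeR R =>
     (expR ((z.2 - theta) * \sum_(j < k) X j z.1
       - k%:R * ((psi \_ Theta) z.2 - psi theta)) * \1_Theta z.2)%:E).
Proof.
have mT : measurable (Theta : set (measurableTypeR R)) by exact: open_measurable.
apply/measurable_EFinP; apply: measurable_funM; last first.
  by apply: measurableT_comp => //; exact: measurable_snd.
apply: measurableT_comp => //; apply: measurable_funB.
  apply: measurable_funM; first by apply: measurable_funB.
  by apply: measurableT_comp (measurable_sum_prefix X k) _.
apply: measurable_funM => //; apply: measurable_funB => //.
apply: measurableT_comp => //.
exact/(measurable_restrictT _ _).1.
Qed.

Lemma measurable_mixture_lr theta k :
  measurable_fun [set: Omega] (mixture_lr psi Theta theta X H k).
Proof.
have -> : mixture_lr psi Theta theta X H k = fubini_F H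
    (fun z : Omega * measurableTypeR R =>
     (expR ((z.2 - theta) * \sum_(j < k) X j z.1
       - k%:R * ((psi \_ Theta) z.2 - psi theta)) * \1_Theta z.2)%:E).
  by apply/funext => w; exact: mixture_lrE.
apply: (measurable_fun_fubini_tonelli_F (m2 := H) _ (mJ theta k)).
by move=> z; rewrite lee_fin mulr_ge0 ?expR_ge0.
Qed.

(* Tonelli: under P theta every likelihood ratio against f_theta has mean 1. *)
Lemma mixture_lr_mean theta k : Theta theta ->
  (\int[P theta]_w mixture_lr psi Theta theta X H k w <= 1)%E.
Proof.
move=> Tt.
under eq_integral do rewrite mixture_lrE.
rewrite (fubini_tonelli (m1 := P theta) (m2 := H) _ (mJ theta k)); last first.
  by move=> z; rewrite lee_fin mulr_ge0 ?expR_ge0.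
apply: (@le_trans _ _ (\int[H]_y cst 1 y)%E); last first.
  by rewrite integral_cst// mul1e probability_le1.
apply: ge0_le_integral_nomeas => y _ /=.
  by apply: integral_ge0 => w _; rewrite lee_fin mulr_ge0 ?expR_ge0.
rewrite /patch indicE; case: ifPn => [/set_mem Ty|_]; last first.
  by under eq_integral do rewrite mulr0; rewrite integral0 lee01.
under eq_integral do rewrite mulr1 expRD EFinM.
rewrite ge0_integralZr//.
- rewrite expfam_sum_mgf// -EFinM -expRD subrr expR0//.
- apply/measurable_EFinP; apply: measurableT_comp => //.
  by apply: measurable_funM => //; exact: measurable_sum_prefix.
Qed.

End exponential_family.

(** * The log-partition function and the information *)

Section real_analysis.
Context (R : realType).
Implicit Types (f : R -> R) (a b : R).

(** A Lebesgue number argument. The local hypothesis is about pairs of points near [x], so that it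
    survives moving the centre. *)
Lemma segment_uniform a b (Q : R -> R -> Prop) :
  (forall x, a <= x <= b -> exists2 r : R, 0 < r &
    forall y z, `|y - x| < r -> `|z - x| < r -> Q y z) ->
  exists2 r : R, 0 < r & forall x, a <= x <= b ->
    forall y, `|y - x| < r -> Q x y.
Proof.
move=> locQ.
have /compact_near_coveringP := @segment_compact R a b.
move=> /(_ R 0^'+ (fun r x => forall y, `|y - x| < r -> Q x y) _) covab.
have /covab : forall x, `[a, b]%classic x ->
    \forall x' \near x & i \near 0^'+, forall y, `|y - x'| < i -> Q x' y.
  move=> x; rewrite /= in_itv/= => /locQ[r r0 Qr].
  exists (ball x (r / 2), [set i : R | i < r / 2]) => /=.
    split; first by apply: nbhsx_ballx; rewrite divr_gt0.
    by apply: nbhs_right_lt; rewrite divr_gt0.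
  move=> [x' i] [/= xx' ir] y yx'; apply: Qr.
    by rewrite distrC; apply: lt_le_trans xx' _; lra.
  rewrite (_ : y - x = (y - x') + (x' - x)); last by ring.
  rewrite (le_lt_trans (ler_normD _ _))// (splitr r) ltrD//.
    exact: lt_trans yx' ir.
  by rewrite distrC.
move=> hnear.
have h0 : \forall r \near 0^'+, 0 < r :> R by exact: nbhs_right_gt.
have [r [r0 Hr]] :=
  @filter_ex _ _ (at_right_proper_filter (0 : R)) _ (filterI h0 hnear).
by exists r => // x xab; apply: Hr; rewrite /= in_itv.
Qed.

(** Besides uniform continuity, the radius keeps a whole neighbourhood of the segment inside [U],
    which leaves room for tilted parameters [theta + t]. *)
Lemma segment_unif_continuous a b f (U : set R) : open U ->
  (forall x, a <= x <= b -> U x /\ {for x, continuous f}) ->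
  forall e, 0 < e -> exists2 r : R, 0 < r & forall x, a <= x <= b ->
    forall y, `|y - x| < r -> U y /\ `|f y - f x| <= e.
Proof.
move=> oU cf e e0; apply: segment_uniform => x /cf[Ux cfx].
have e2 : 0 < e / 2 by rewrite divr_gt0.
have /nbhs_ballP[r1 /= r10 Hr1] : nbhs x U by exact: open_nbhs_nbhs.
have /cvgrPdist_lt/(_ _ e2)/nbhs_ballP[r2 /= r20 Hr2] := cfx.
exists (Num.min r1 r2); first by rewrite lt_min r10.
move=> y z; rewrite !lt_min ![`|_ - x|]distrC => /andP[y1 y2] /andP[z1 z2].
split; first exact: Hr1.
rewrite (_ : f z - f y = (f x - f y) - (f x - f z)); last by ring.
rewrite (le_trans (ler_normB _ _))// (splitr e) lerD// ltW//; exact: Hr2.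
Qed.

Lemma interval_MVT (Theta : set R) f x y : is_interval Theta ->
  (forall z, Theta z -> derivable f z 1) -> Theta x -> Theta y -> x < y ->
  exists2 z : R, x < z < y & f y - f x = derive1 f z * (y - x).
Proof.
move=> itv df Tx Ty xy.
have Tz z : x <= z <= y -> Theta z by exact: itv.
have [z||z] := @MVT R f (derive1 f) x y xy.
- rewrite in_itv/= => /andP[xz zy]; apply: DeriveDef.
    by apply: df; apply: Tz; rewrite !ltW.
  by rewrite derive1E.
- apply: derivable_within_continuous => z; rewrite in_itv/= => xzy.
  by apply: df; exact: Tz.
- by rewrite in_itv/= => xzy ->; exists z.
Qed.

Lemma derivable_continuous f x : derivable f x 1 -> {for x, continuous f}.
Proof. by move=> /derivable1_diffP /differentiable_continuous. Qed.

Lemma open_interval_widen (Theta : set R) x : open Theta -> Theta x ->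
  exists2 r : R, 0 < r & forall y, `|y - x| < r -> Theta y.
Proof.
move=> oT Tx.
have /nbhs_ballP[r /= r0 Hr] : nbhs x Theta by exact: open_nbhs_nbhs.
by exists r => // y; rewrite distrC => yx; exact: Hr.
Qed.

End real_analysis.

Section log_partition.
Context (R : realType) (psi : R -> R) (Theta : set R) (theta0 : R).
Hypothesis Theta_open : open Theta.
Hypothesis Theta_itv : is_interval Theta.
Hypothesis psi_derivable : forall theta, Theta theta ->
  derivable psi theta 1 /\ derivable (derive1 psi) theta 1.
Hypothesis psi''_gt0 : forall theta, Theta theta -> 0 < derive1 (derive1 psi) theta.

Lemma psi_continuous x : Theta x -> {for x, continuous psi}.
Proof. by move=> /psi_derivable[/derivable_continuous]. Qed.

Lemma dpsi_continuous x : Theta x -> {for x, continuous (derive1 psi)}.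
Proof. by move=> /psi_derivable[_ /derivable_continuous]. Qed.

Lemma info_continuous x : Theta x -> {for x, continuous (info psi ^~ theta0)}.
Proof.
move=> Tx; rewrite /info; apply: cvgB.
  apply: cvgM; last exact: dpsi_continuous.
  by apply: cvgB; [exact: cvg_id|exact: cvg_cst].
by apply: cvgB; [exact: psi_continuous|exact: cvg_cst].
Qed.

Lemma measurable_continuous_on (f : R -> R) :
  (forall x, Theta x -> {for x, continuous f}) -> measurable_fun Theta f.
Proof.
move=> cf; apply: open_continuous_measurable_fun => // x /set_mem.
exact: cf.
Qed.

Lemma dpsi_lt x y : Theta x -> Theta y -> x < y -> derive1 psi x < derive1 psi y.
Proof.
move=> Tx Ty xy.
have [z /andP[xz zy] E] := interval_MVT Theta_itv
  (fun z Tz => (psi_derivable Tz).2) Tx Ty xy.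
rewrite -subr_gt0 E mulr_gt0 ?subr_gt0//; apply: psi''_gt0.
by apply: (Theta_itv Tx Ty); rewrite !ltW.
Qed.

Lemma dpsi_le x y : Theta x -> Theta y -> x <= y -> derive1 psi x <= derive1 psi y.
Proof.
by move=> Tx Ty; rewrite le_eqVlt => /predU1P[->//|xy]; rewrite ltW// dpsi_lt.
Qed.

Lemma psi_tangent_le x y : Theta x -> Theta y ->
  psi x + (y - x) * derive1 psi x <= psi y.
Proof.
move=> Tx Ty; have [xy|yx|->] := ltgtP x y; last by rewrite subrr mul0r addr0.
  have [z /andP[xz zy] E] := interval_MVT Theta_itv
    (fun z Tz => (psi_derivable Tz).1) Tx Ty xy.
  rewrite -lerBrDl E mulrC ler_pM2r ?subr_gt0// dpsi_le ?ltW//.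
  by apply: (Theta_itv Tx Ty); rewrite !ltW.
have [z /andP[xz zy] E] := interval_MVT Theta_itv
  (fun z Tz => (psi_derivable Tz).1) Ty Tx yx.
have Tz : Theta z by apply: (Theta_itv Ty Tx); rewrite !ltW.
have : derive1 psi z * (x - y) <= derive1 psi x * (x - y).
  by rewrite ler_pM2r ?subr_gt0// dpsi_le ?ltW.
by rewrite -E; lra.
Qed.

(** The difference of the two sides is the gap at [x] between [psi] and its tangent at [y],
    nonnegative by convexity. This replaces integrating the derivative [(x - theta0) * psi''(x)] of
    the information, and gives its monotonicity away from [theta0]. *)
Lemma info_incr_ge x y : Theta x -> Theta y ->
  (x - theta0) * (derive1 psi y - derive1 psi x) <=
  info psi y theta0 - info psi x theta0.
Proof. by move=> Tx Ty; have := psi_tangent_le Ty Tx; rewrite /info; lra. Qed.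

Lemma info_ltr x y : Theta x -> Theta y -> theta0 < x -> x < y ->
  info psi x theta0 < info psi y theta0.
Proof.
move=> Tx Ty x0 xy; rewrite -subr_gt0 (lt_le_trans _ (info_incr_ge Tx Ty))//.
by rewrite mulr_gt0 ?subr_gt0// dpsi_lt.
Qed.

Lemma info_ltl x y : Theta x -> Theta y -> x < theta0 -> y < x ->
  info psi x theta0 < info psi y theta0.
Proof.
move=> Tx Ty x0 yx; rewrite -subr_gt0 (lt_le_trans _ (info_incr_ge Tx Ty))//.
by rewrite nmulr_rgt0 ?subr_lt0// dpsi_lt.
Qed.

(** The error is [t] times an increment of the derivative of [psi], small by uniform continuity on
    the segment. It makes the exponent of a tilt by [t] linear up to [e] times |t|, which yields
    Chernoff rates independent of the parameter. *)
Lemma psi_unif_derivable a b e : (forall x, a <= x <= b -> Theta x) -> 0 < e ->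
  exists2 r : R, 0 < r & forall x, a <= x <= b -> forall t, `|t| < r ->
    Theta (x + t) /\
    `|psi (x + t) - psi x - t * derive1 psi x| <= e * `|t|.
Proof.
move=> abT e0.
have [r r0 Hr] := @segment_unif_continuous R a b (derive1 psi) Theta Theta_open
  (fun x xab => conj (abT x xab) (dpsi_continuous (abT x xab))) e e0.
exists r => // x xab t tr; have Tx := abT x xab.
have Txt : Theta (x + t).
  by apply: (Hr x xab (x + t) _).1; rewrite addrAC subrr add0r.
split => //.
have [t0|t0|->] := ltgtP t 0.
- have yx : x + t < x by rewrite gtrDl.
  have [z /andP[xz zy] E] := interval_MVT Theta_itv
    (fun z Tz => (psi_derivable Tz).1) Txt Tx yx.
  have -> : psi (x + t) - psi x - t * derive1 psi x =
      (derive1 psi z - derive1 psi x) * t.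
    by move: E; rewrite (_ : x - (x + t) = - t); [lra|ring].
  rewrite normrM ler_pM2r ?normr_gt0 ?lt_eqF//; apply: (Hr x xab z _).2.
  rewrite (ltr0_norm t0) in tr.
  by rewrite ltr0_norm ?subr_lt0// opprB; lra.
- have yx : x < x + t by rewrite ltrDl.
  have [z /andP[xz zy] E] := interval_MVT Theta_itv
    (fun z Tz => (psi_derivable Tz).1) Tx Txt yx.
  have -> : psi (x + t) - psi x - t * derive1 psi x =
      (derive1 psi z - derive1 psi x) * t.
    by move: E; rewrite (_ : (x + t) - x = t); [lra|ring].
  rewrite normrM ler_pM2r ?normr_gt0 ?gt_eqF//; apply: (Hr x xab z _).2.
  rewrite (gtr0_norm t0) in tr.
  by rewrite gtr0_norm ?subr_gt0//; lra.
- by rewrite addr0 subrr mul0r subrr normr0 mulr0.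
Qed.

Lemma continuous_bounded_on a b (f : R -> R) :
  (forall x, a <= x <= b -> Theta x) ->
  (forall x, Theta x -> {for x, continuous f}) ->
  exists2 K : R, 0 < K & forall x, a <= x <= b -> `|f x| <= K.
Proof.
move=> abT cf; have [ba|ab] := ltP b a.
  by exists 1 => // x /andP[ax xb]; move: (le_lt_trans (le_trans ax xb) ba); rewrite ltxx.
have cnf : {within `[a, b], continuous (fun x => `|f x|)}.
  apply: continuous_in_subspaceT => x /set_mem; rewrite /= in_itv/= => xab.
  by apply: continuous_comp; [exact/cf/abT|exact: norm_continuous].
have [c cab Hc] := EVT_max ab cnf.
exists (`|f c| + 1); first by rewrite ltr_wpDl.
by move=> x xab; rewrite ler_wpDr//; apply: Hc; rewrite in_itv.
Qed.

End log_partition.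

(** * Tail bounds *)

Section tail_bounds.
Context d (T : measurableType d) (R : realType) (P : probability T R).

Lemma markov_ge0 (f : T -> \bar R) (c : R) : measurable_fun [set: T] f ->
  (forall w, 0 <= f w)%E -> 0 < c ->
  (c%:E * P [set w | c%:E <= f w] <= \int[P]_w f w)%E.
Proof.
move=> mf f0 c0.
have := @le_integral_abse _ _ R P setT measurableT f c mf c0.
rewrite setTI (eq_integral f); last by move=> w _; rewrite gee0_abs.
congr (_ * P _ <= _)%E; apply/seteqP; split => w /=; rewrite gee0_abs//.
Qed.

End tail_bounds.

Section chernoff_bounds.
Context (R : realType) (d : measure_display) (Omega : measurableType d).
Context (mu : {sigma_finite_measure set (measurableTypeR R) -> \bar R}).
Context (f0 psi : R -> R) (Theta : set R) (theta0 : R).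
Context (P : R -> probability Omega R) (X : nat -> {mfun Omega >-> R}).
Hypothesis f0_meas : measurable_fun [set: measurableTypeR R] f0.
Hypothesis f0_ge0 : forall x, 0 <= f0 x.
Hypothesis Theta_open : open Theta.
Hypothesis iid : iid_expfam mu f0 psi Theta P X.
Hypothesis psi_meas : measurable_fun Theta psi.

(** Exponential Markov inequality. The sign of [t] is free, so that both tails are covered. *)
Lemma chernoff_sum theta t y k : Theta theta -> Theta (theta + t) ->
  (P theta [set w | y <= t * \sum_(j < k) X j w]%R <=
   (expR (k%:R * (psi (theta + t) - psi theta) - y))%:E)%E.
Proof.
move=> Tt Tt'.
have mS : measurable_fun [set: Omega]
    (fun w => (expR (t * \sum_(j < k) X j w))%:E).
  apply/measurable_EFinP; apply: measurableT_comp => //.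
  by apply: measurable_funM => //; exact: measurable_sum_prefix.
have := @markov_ge0 _ _ R (P theta) _ (expR y) mS
  (fun w => _) (expR_gt0 y).
have -> : [set w | ((expR y)%:E <= (expR (t * \sum_(j < k) X j w))%:E)%E] =
    [set w | y <= t * \sum_(j < k) X j w].
  by apply/seteqP; split => w /=; rewrite lee_fin ler_expR.
have := @expfam_sum_mgf _ _ _ mu f0 psi Theta P X f0_meas f0_ge0 iid
  theta (theta + t) k Tt Tt'.
rewrite (_ : theta + t - theta = t); last by ring.
move=> ->.
move=> /(_ (fun w => ltac:(by rewrite lee_fin expR_ge0))).
rewrite expRD expRN EFinM lee_pdivlMr ?expR_gt0// muleC//.
Qed.

(* The likelihood ratio against theta0 splits as the one against theta, whose
   mean is at most 1, times dP_theta / dP_theta0. *)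
Lemma mixture_lr_shift (H : probability (measurableTypeR R) R) theta k w :
  (mixture_lr psi Theta theta0 X H k w =
   (expR ((theta - theta0) * \sum_(j < k) X j w
          - k%:R * (psi theta - psi theta0)))%:E *
   mixture_lr psi Theta theta X H k w)%E.
Proof.
rewrite !mixture_lrE -ge0_integralZl//.
- apply: eq_integral => x _; rewrite -EFinM mulrA -expRD.
  by congr (expR _ * _)%:E; ring.
- apply/measurable_EFinP; apply: measurable_funM; last first.
    by apply: measurable_indic; exact: open_measurable.
  apply: measurableT_comp => //; apply: measurable_funB.
    by apply: measurable_funM => //; exact: measurable_funB.
  apply: measurable_funM => //; apply: measurable_funB => //.
  apply/(measurable_restrictT _ _).1 => //; exact: open_measurable.
Qed.

(** The threshold exponent is shared between the two factors of [mixture_lr_shift]: Markov pays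
    [expR (- u)] for the mean-one factor, and the log-likelihood ratio must supply [v]. *)
Lemma mixture_lr_tail (H : probability (measurableTypeR R) R) theta k (u v : R) :
  Theta theta ->
  (P theta [set w | (expR (u + v))%:E <= mixture_lr psi Theta theta0 X H k w] <=
   (expR (- u))%:E + P theta [set w | v <=
      (theta - theta0) * \sum_(j < k) X j w - k%:R * (psi theta - psi theta0)]%R)%E.
Proof.
move=> Tt.
set A := [set w | _]; set B := [set w | v <= _]%R.
pose C := [set w | ((expR u)%:E <= mixture_lr psi Theta theta X H k w)%E].
have mL th : measurable_fun [set: Omega] (mixture_lr psi Theta th X H k).
  exact: measurable_mixture_lr.
have mA : measurable A.
  rewrite /A -[X in measurable X]setTI.
  exact: (emeasurable_fun_c_infty measurableT (mL theta0)).
have mC : measurable C.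
  rewrite /C -[X in measurable X]setTI.
  exact: (emeasurable_fun_c_infty measurableT (mL theta)).
have mB : measurable B.
  rewrite /B -[X in measurable X]setTI.
  apply: measurable_fun_le => //; apply: measurable_funB => //.
  by apply: measurable_funM => //; exact: measurable_sum_prefix.
have AsubCB : A `<=` C `|` B.
  move=> w; rewrite /A /C /B /= => Aw.
  have [Bw|Bw] := leP v ((theta - theta0) * \sum_(j < k) X j w
      - k%:R * (psi theta - psi theta0)); first by right.
  left; rewrite leNgt; apply/negP => Cw.
  move: Aw; rewrite leNgt => /negP; apply.
  rewrite (mixture_lr_shift H theta) expRD muleC EFinM.
  apply: lte_pmul => //; last by rewrite lte_fin ltr_expR.
  by apply: integral_ge0 => x _; rewrite lee_fin expR_ge0.
apply: (@le_trans _ _ (P theta (C `|` B))).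
  by apply: le_measure => //; rewrite inE//; exact: measurableU.
apply: (@le_trans _ _ (P theta C + P theta B)%E).
  exact: measureU2.
rewrite leeD2r//.
have := @markov_ge0 _ _ R (P theta) _ (expR u) (mL theta) _ (expR_gt0 u).
have L0 w : (0 <= mixture_lr psi Theta theta X H k w)%E.
  by apply: integral_ge0 => x _; rewrite lee_fin expR_ge0.
move=> /(_ L0) h.
rewrite expRN -[leRHS]mul1e lee_pdivlMr ?expR_gt0// muleC.
by apply: (le_trans h); apply: (mixture_lr_mean (mu := mu) (f0 := f0)).
Qed.

End chernoff_bounds.

(** * Run-length bounds *)

Lemma integral_probability_cst d (T : measurableType d) (R : realType)
  (P : probability T R) (c : R) : (\int[P]_w (cst c%:E w) = c%:E)%E.
Proof.
rewrite integral_cst//; transitivity (c%:E * 1)%E; last by rewrite mule1.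
by congr (_ * _)%E; exact: probability_setT.
Qed.

Section run_length.
Context (R : realType) (d : measure_display) (Omega : measurableType d).
Context (psi : R -> R) (Theta : set R) (theta0 : R).
Context (X : nat -> {mfun Omega >-> R}).
Context (H : probability (measurableTypeR R) R) (M : nat) (alpha : R).

Local Notation T := (trunc_stop_time psi Theta theta0 X H M alpha).
Local Notation Lam := (mixture_lr psi Theta theta0 X H).

Lemma stop_time_ge w (x : \bar R) :
  (forall k, (0 < k)%N -> ((alpha^-1)%:E <= Lam k w)%E -> (x <= k%:R%:E)%E) ->
  (x <= stop_time psi Theta theta0 X H alpha w)%E.
Proof. by move=> h; apply: le_ereal_inf_tmp => _ [k [k0 kL] <-]; exact: h. Qed.

Lemma trunc_stop_time_ge0 w : (0 <= T w)%E.
Proof.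
by rewrite /trunc_stop_time le_min lee_fin ler0n andbT stop_time_ge.
Qed.

Lemma trunc_stop_time_leM w : (T w <= M%:R%:E)%E.
Proof. by rewrite /trunc_stop_time ge_min lexx orbT. Qed.

Lemma trunc_stop_time_le w n : (0 < n)%N -> ((alpha^-1)%:E <= Lam n w)%E ->
  (T w <= n%:R%:E)%E.
Proof.
move=> n0 nL; rewrite /trunc_stop_time ge_min; apply/orP; left.
by apply: ereal_inf_lbound; exists n.
Qed.

(** Index [k < n] stands for sample size [k.+1]: without a crossing at sizes 1 to [n], stopping
    occurs at [n.+1] at the earliest. Hence a real horizon [x] can be used with [n] its integer
    part. *)
Lemma trunc_stop_time_ge w n (x : R) : x <= n.+1%:R -> x <= M%:R ->
  (forall k, (k < n)%N -> ~ ((alpha^-1)%:E <= Lam k.+1 w)%E) -> (x%:E <= T w)%E.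
Proof.
move=> xn xM h; rewrite /trunc_stop_time le_min lee_fin xM andbT.
apply: stop_time_ge => -[//|k] _ kL.
have [/h//|nk] := ltnP k n.
by rewrite lee_fin (le_trans xn)// ler_nat.
Qed.

Context (P : R -> probability Omega R).
Local Notation rho := (run_length_profile psi Theta theta0 X P H M alpha).

Lemma integral_trunc_fin theta : (\int[P theta]_w T w)%E \is a fin_num.
Proof.
rewrite ge0_fin_numE; last by apply: integral_ge0 => w _; exact: trunc_stop_time_ge0.
apply: (@le_lt_trans _ _ (\int[P theta]_w (cst M%:R%:E w))%E).
  by apply: ge0_le_integral_nomeas => w _; [exact: trunc_stop_time_ge0|
     exact: trunc_stop_time_leM].
by rewrite integral_probability_cst ltry.
Qed.

Hypothesis M0 : (0 < M)%N.

Lemma profile_ge theta x : (x%:E <= \int[P theta]_w T w)%E -> x / M%:R <= rho theta.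
Proof.
by move=> h; rewrite ler_pM2r ?invr_gt0 ?ltr0n// -lee_fin fineK// integral_trunc_fin.
Qed.

Lemma profile_le theta x : (\int[P theta]_w T w <= x%:E)%E -> rho theta <= x / M%:R.
Proof.
by move=> h; rewrite ler_pM2r ?invr_gt0 ?ltr0n// -lee_fin fineK// integral_trunc_fin.
Qed.

Lemma profile_ge0 theta : 0 <= rho theta.
Proof.
rewrite -(mul0r (M%:R^-1)) profile_ge//.
by apply: integral_ge0 => w _; exact: trunc_stop_time_ge0.
Qed.

Lemma profile_le1 theta : rho theta <= 1.
Proof.
rewrite -(@divff _ (M%:R : R)) ?pnatr_eq0 -?lt0n// profile_le//.
apply: (@le_trans _ _ (\int[P theta]_w (cst M%:R%:E w))%E).
  by apply: ge0_le_integral_nomeas => w _; [exact: trunc_stop_time_ge0|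
     exact: trunc_stop_time_leM].
by rewrite integral_probability_cst.
Qed.

Lemma profile_ge_of_event theta n (x : R) (B : set Omega) : measurable B ->
  0 <= x -> x <= n.+1%:R -> x <= M%:R ->
  (forall w, ~ B w -> forall k, (k < n)%N -> ~ ((alpha^-1)%:E <= Lam k.+1 w)%E) ->
  x / M%:R * (1 - fine (P theta B)) <= rho theta.
Proof.
move=> mB x0 xn xM h; rewrite mulrAC; apply: profile_ge.
have mBC : measurable (~` B) by exact: measurableC.
have -> : (x * (1 - fine (P theta B)))%:E = (\int[P theta]_w (x * \1_(~` B) w)%:E)%E.
  under eq_integral do rewrite EFinM.
  rewrite ge0_integralZl//; last exact/measurable_EFinP/measurable_indic.
  rewrite integral_indic// setIT EFinM; congr (_ * _)%E.
  transitivity (1 - P theta B)%E; last by apply/esym; exact: probability_setC.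
  by rewrite EFinB fineK// fin_num_measure.
apply: ge0_le_integral_nomeas => w _; first by rewrite lee_fin mulr_ge0.
rewrite indicE; have [/set_mem Bw|_] := boolP (w \in ~` B); last by rewrite mulr0 trunc_stop_time_ge0.
rewrite mulr1; apply: trunc_stop_time_ge xn xM _; exact: h.
Qed.

(** The truncated time is at most [n] off [B] and at most [M] everywhere; after division by [M] the
    event [B] costs only its probability. *)
Lemma profile_le_of_event theta n (B : set Omega) : measurable B ->
  (0 < n)%N -> (forall w, ~ B w -> ((alpha^-1)%:E <= Lam n w)%E) ->
  rho theta <= n%:R / M%:R + fine (P theta B).
Proof.
move=> mB n0 h.
have -> : n%:R / M%:R + fine (P theta B) =
    (n%:R + M%:R * fine (P theta B)) / M%:R.
  by rewrite mulrDl mulrAC divff ?mul1r// pnatr_eq0 -lt0n.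
apply: profile_le.
have -> : (n%:R + M%:R * fine (P theta B))%:E =
    (\int[P theta]_w (n%:R + M%:R * \1_B w)%:E)%E.
  under eq_integral do rewrite EFinD.
  rewrite ge0_integralD//; last first.
    by apply/measurable_EFinP; apply: measurable_funM => //; exact: measurable_indic.
  rewrite integral_probability_cst.
  under eq_integral do rewrite EFinM.
  rewrite ge0_integralZl//; last exact/measurable_EFinP/measurable_indic.
  rewrite integral_indic// setIT EFinD EFinM fineK//.
  exact: fin_num_measure.
apply: ge0_le_integral_nomeas => w _; first exact: trunc_stop_time_ge0.
rewrite indicE; have [_|/negP Bw] := boolP (w \in B).
  by rewrite mulr1 (le_trans (trunc_stop_time_leM w))// lee_fin lerDr.
by rewrite mulr0 addr0; apply: trunc_stop_time_le => //; apply: h => /mem_set.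
Qed.

End run_length.

(** From exp y >= y^2 / 2 at [y = a * L]; the extra 1 in the threshold secures [1 <= L0]. *)
Lemma mul_expRN_small (R : realType) (a K e : R) : 0 < a -> 0 <= K -> 0 < e ->
  exists2 L0 : R, 1 <= L0 & forall L, L0 <= L -> K * L * expR (- (a * L)) <= e.
Proof.
move=> a0 K0 e0; have ae0 : 0 < a ^+ 2 * e by rewrite mulr_gt0 ?exprn_gt0.
have q0 : 0 <= 2 * K / (a ^+ 2 * e) by rewrite divr_ge0 ?(ltW ae0)// mulr_ge0.
exists (1 + 2 * K / (a ^+ 2 * e)); first by rewrite lerDl.
move=> L hL.
have L1 : 1 <= L by apply: le_trans hL; rewrite lerDl.
have L0 : 0 < L by apply: lt_le_trans L1.
have h2 : 2 * K <= L * (a ^+ 2 * e).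
  by rewrite -ler_pdivrMr// (le_trans _ hL)// lerDr.
rewrite expRN ler_pdivrMr ?expR_gt0//.
have := @expR_ge1Dxn _ (a * L) 1 (mulr_ge0 (ltW a0) (ltW L0)).
rewrite (_ : 2`!%:R = 2 :> R)// => h.
have h3 : e * ((a * L) ^+ 2 / 2) <= e * expR (a * L).
  by rewrite ler_pM2l// (le_trans _ h)// lerDr.
apply: le_trans h3.
have : 2 * K * L <= L * (a ^+ 2 * e) * L by rewrite ler_pM2r.
by rewrite exprMn; nra.
Qed.

Section run_length_bounds.
Context (R : realType) (d : measure_display) (Omega : measurableType d).
Context (mu : {sigma_finite_measure set (measurableTypeR R) -> \bar R}).
Context (f0 psi : R -> R) (Theta : set R) (theta0 : R).
Context (P : R -> probability Omega R) (X : nat -> {mfun Omega >-> R}).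
Hypothesis f0_meas : measurable_fun [set: measurableTypeR R] f0.
Hypothesis f0_ge0 : forall x, 0 <= f0 x.
Hypothesis Theta_open : open Theta.
Hypothesis Theta_itv : is_interval Theta.
Hypothesis iid : iid_expfam mu f0 psi Theta P X.
Hypothesis psi_derivable : forall theta, Theta theta ->
  derivable psi theta 1 /\ derivable (derive1 psi) theta 1.

Let psi_meas : measurable_fun Theta psi.
Proof. by apply: measurable_continuous_on => //; exact: psi_continuous. Qed.

Local Notation I := (info psi ^~ theta0).

Let dist_bounded a b : (forall x, a <= x <= b -> Theta x) ->
  exists2 K : R, 0 < K & forall x, a <= x <= b -> `|x - theta0| <= K.
Proof.
move=> abT; apply: (@continuous_bounded_on _ Theta) => // x _.
by apply: cvgB; [exact: cvg_id|exact: cvg_cst].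
Qed.

(* Chernoff bound for the log-likelihood ratio, uniform on compact sets and
   over all sample sizes up to a multiple of L. *)
Lemma llr_tail a b C e : (forall x, a <= x <= b -> Theta x) -> 0 < e -> 0 <= C ->
  exists2 s : R, 0 < s & forall L theta k, 0 < L -> a <= theta <= b ->
    k%:R <= C * L -> k%:R * I theta <= (1 - e) * L ->
    (P theta [set w | (1 - e / 2) * L <=
       (theta - theta0) * \sum_(j < k) X j w - k%:R * (psi theta - psi theta0)]%R
     <= (expR (- (s * e / 4 * L)))%:E)%E.
Proof.
move=> abT e0 C0; have [B B0 HB] := dist_bounded abT.
(* Makes [e1 * C * B <= e / 4]: with [k <= C * L] and |t| at most [s * B], linearizing [psi] costs
   at most [s * e / 4 * L], half of the margin between [1 - e] and [1 - e / 2]. *)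
pose e1 := e / (4 * (C * B + 1)).
have CB0 : 0 <= C * B by rewrite mulr_ge0// ltW.
have CB1 : 0 < 4 * (C * B + 1) by lra.
have e10 : 0 < e1 by rewrite divr_gt0.
have e1CB : e1 * (4 * (C * B + 1)) = e by rewrite divfK// gt_eqF.
have [r r0 Hr] := psi_unif_derivable Theta_open Theta_itv psi_derivable abT e10.
have s0 : 0 < r / (2 * B) by rewrite divr_gt0// mulr_gt0.
have sB : r / (2 * B) * B = r / 2 by rewrite invfM mulrA divfK// gt_eqF.
move: s0 sB; set s := r / (2 * B) => s0 sB.
exists s => // L theta k L0 tab kC kI.
have Bt := HB _ tab; have Tt := abT _ tab.
(* A tilt proportional to [theta - theta0] makes [t] times the sum equal to [s] times the random
   part of the log-likelihood ratio; [s] is small enough for the tilt to stay within radius [r]. *)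
pose t := s * (theta - theta0).
have tB : `|t| <= s * B by rewrite normrM gtr0_norm// ler_pM2l.
have [Ttt psit] := Hr theta tab t ltac:(by rewrite (le_lt_trans tB)// sB; lra).
set A := [set w | _].
have -> : A = [set w | s * ((1 - e / 2) * L + k%:R * (psi theta - psi theta0))
    <= t * \sum_(j < k) X j w].
  apply/seteqP; split => w; rewrite /A/= /t -mulrA ler_pM2l// lerBrDr//.
apply: (le_trans (chernoff_sum f0_meas f0_ge0 iid _ k Tt Ttt)).
rewrite lee_fin ler_expR.
have h1 : psi (theta + t) - psi theta <= t * derive1 psi theta + e1 * `|t|.
  by rewrite -lerBlDl (le_trans (ler_norm _)).
have h2 : psi (theta + t) - psi theta - s * (psi theta - psi theta0)
    <= s * I theta + e1 * (s * B).
  have : e1 * `|t| <= e1 * (s * B) by rewrite ler_pM2l.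
  by move: h1; rewrite /info /t; lra.
have k0 : 0 <= k%:R :> R by [].
have h3 : k%:R * (psi (theta + t) - psi theta - s * (psi theta - psi theta0))
    <= s * ((1 - e) * L) + s * (e / 4 * L).
  apply: (le_trans (ler_wpM2l k0 h2)).
  have -> : k%:R * (s * I theta + e1 * (s * B)) =
    s * (k%:R * I theta) + s * (e1 * B * k%:R) by ring.
  apply: lerD; rewrite ler_pM2l//.
  apply: (@le_trans _ _ (e1 * B * (C * L))).
    by rewrite ler_pM2l// mulr_gt0.
  rewrite (_ : e1 * B * (C * L) = (e1 * (C * B)) * L); last by ring.
  by rewrite ler_pM2r//; lra.
by lra.
Qed.

(** A union bound: at most [C * L] sample sizes precede the horizon, and each crosses with
    probability exponentially small in [L]. The quotient by the maximum is min(1, c / I) written so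
    that it makes sense at [theta0], where the information vanishes. One [e] pays for shortening the
    horizon, the other for the crossing event. *)
Lemma run_length_lower a b C e :
  (forall x, a <= x <= b -> Theta x) -> 0 < e -> 0 <= C ->
  exists L0 : R, forall (alpha : R) (M : nat) (H : probability (measurableTypeR R) R)
      (theta : R),
    0 < alpha -> L0 <= ln alpha^-1 -> (0 < M)%N -> M%:R <= C * ln alpha^-1 ->
    a <= theta <= b ->
    ln alpha^-1 / M%:R / Num.max (ln alpha^-1 / M%:R) (I theta) - 2 * e <=
    run_length_profile psi Theta theta0 X P H M alpha theta.
Proof.
move=> abT e0 C0; have [s s0 tail] := llr_tail abT e0 C0.
have [L1 L11 HL1] := mul_expRN_small (divr_gt0 e0 (ltr0n R 2)) C0 (divr_gt0 e0 (ltr0n R 2)).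
have se0 : 0 < s * e / 4 by rewrite divr_gt0// mulr_gt0.
have [L2 L21 HL2] := mul_expRN_small se0 C0 (divr_gt0 e0 (ltr0n R 2)).
exists (Num.max L1 L2) => alpha M H theta a0; rewrite ge_max => /andP[LL1 LL2] M0 MC tab.
set L := ln alpha^-1 in LL1 LL2 MC *; set c := L / M%:R.
have L0 : 0 < L by rewrite (lt_le_trans _ LL1)// (lt_le_trans _ L11).
have Mr0 : 0 < M%:R :> R by rewrite ltr0n.
have c0 : 0 < c by rewrite divr_gt0.
set m := Num.max c (I theta); have m0 : 0 < m by rewrite lt_max c0.
have t0 : 0 < c / m by rewrite divr_gt0.
have t1 : c / m <= 1 by rewrite ler_pdivrMr// mul1r le_max lexx.
(* Here the claimed lower bound is negative, since the quotient is at most 1. *)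
have [e1|e1] := leP 1 e.
  apply: (@le_trans _ _ 0); first by lra.
  exact: profile_ge0.
have alphaE : alpha^-1 = expR L by rewrite lnK// posrE invr_gt0.
(* [M * (c / m)] is [L / m], the smaller of [M] and [L / I] when the information is positive. *)
pose x := (1 - e) * (M%:R * (c / m)).
have x0 : 0 <= x.
  by apply: mulr_ge0; [rewrite subr_ge0 ltW|rewrite mulr_ge0// ltW].
pose n := Num.truncn x.
have /andP[nx xn] := truncn_itv x0.
have xM : x <= M%:R.
  have h : M%:R * (c / m) <= M%:R by rewrite ler_piMr// ltW.
  have : 0 <= M%:R * (c / m) by rewrite mulr_ge0 ?ltW.
  by rewrite /x; nra.
pose E k := [set w | ((alpha^-1)%:E <= mixture_lr psi Theta theta0 X H k.+1 w)%E].
have mE k : measurable (E k).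
  rewrite /E -[X in measurable X]setTI; apply: emeasurable_fun_c_infty => //.
  exact: measurable_mixture_lr.
pose B := \big[setU/set0]_(k < n) E k.
have mB : measurable B by exact: bigsetU_measurable.
have PE k : (k < n)%N -> (P theta (E k) <=
    (expR (- (e / 2 * L)) + expR (- (s * e / 4 * L)))%:E)%E.
  move=> kn; rewrite /E alphaE (_ : expR L = expR (e / 2 * L + (1 - e / 2) * L)); last first.
    by congr expR; ring.
  rewrite EFinD; have /le_trans := mixture_lr_tail theta0 f0_meas f0_ge0 Theta_open iid
    psi_meas H k.+1 (e / 2 * L) ((1 - e / 2) * L) (abT _ tab).
  apply.
  rewrite leeD2l// tail//.
    rewrite (le_trans _ MC)// (le_trans _ xM)// (le_trans _ nx)// ler_nat//.
  have kx : k.+1%:R <= x by rewrite (le_trans _ nx)// ler_nat.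
  have [I0|I0] := leP (I theta) 0.
    apply: (@le_trans _ _ 0); first by rewrite mulr_ge0_le0.
    by rewrite mulr_ge0 ?ltW// subr_gt0.
  apply: (@le_trans _ _ (x * I theta)); first by rewrite ler_pM2r.
  rewrite /x -(mulrA (1 - e)) ler_pM2l ?subr_gt0//.
  have -> : M%:R * (c / m) * I theta = L * (I theta / m).
    by rewrite /c; field; rewrite (gt_eqF m0) (gt_eqF Mr0).
  by rewrite ler_piMr ?(ltW L0)// ler_pdivrMr// mul1r le_max lexx orbT.
have PB : fine (P theta B) <= e.
  rewrite -lee_fin fineK ?fin_num_measure//.
  apply: (@le_trans _ _ (\sum_(k < n) P theta (E k))%E).
    by apply: Boole_inequality => // k _; exact: mE.
  apply: (@le_trans _ _ (\sum_(k < n)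
      (expR (- (e / 2 * L)) + expR (- (s * e / 4 * L)))%:E)%E).
    by apply: lee_sum => k _; exact: PE.
  rewrite sumEFin lee_fin sumr_const card_ord -[X in X <= _]mulr_natl.
  have nC : n%:R <= C * L by rewrite (le_trans nx)// (le_trans xM).
  apply: (@le_trans _ _ (C * L * (expR (- (e / 2 * L)) + expR (- (s * e / 4 * L))))).
    by rewrite ler_wpM2r// addr_ge0// expR_ge0.
  by have := HL1 _ LL1; have := HL2 _ LL2; rewrite mulrDr; lra.
have := @profile_ge_of_event _ _ _ psi Theta theta0 X H M alpha P M0 theta n x B mB x0
  (ltW xn) xM.
move=> h; apply: le_trans (h _); last first.
  by move=> w Bw k kn Ek; apply: Bw; rewrite /B -bigcup_mkord; exists k.
have -> : x / M%:R = (1 - e) * (c / m) by rewrite /x; field; rewrite !gt_eqF.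
have : 0 <= fine (P theta B) by rewrite fine_ge0.
move: PB; set p := fine _ => PB p0.
set t := c / m in t0 t1 *.
have te : t * e <= e by rewrite ler_piMl// ltW.
have tp : t * p <= p by rewrite ler_piMl.
have tpe : 0 <= t * p * e.
  by apply: mulr_ge0 (ltW e0); apply: mulr_ge0 (ltW t0) p0.
by lra.
Qed.


(** Chernoff with the tilts [r / 2] and [- (r / 2)]; linearizing [psi] uses up half of the deviation
    [x], and the other half is the rate. *)
Lemma sample_mean_tail a b x : (forall y, a <= y <= b -> Theta y) -> 0 < x ->
  exists2 s : R, 0 < s & forall theta n, a <= theta <= b ->
    (P theta [set w | n%:R * x <=
       `|\sum_(j < n) X j w - n%:R * derive1 psi theta| ]%R
     <= (2 * expR (- (s * n%:R)))%:E)%E.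
Proof.
move=> abT x0; have x20 : 0 < x / 2 by rewrite divr_gt0.
have [r r0 Hr] := psi_unif_derivable Theta_open Theta_itv psi_derivable abT x20.
exists (r / 2 * (x / 2)); first by rewrite !mulr_gt0.
move=> theta n tab; have Tt := abT _ tab.
have mS := measurable_sum_prefix X n.
pose U (t : R) := [set w | `|t| * n%:R * x + t * n%:R * derive1 psi theta
  <= t * \sum_(j < n) X j w].
have mU t : measurable (U t).
  rewrite /U -[X in measurable X]setTI.
  by apply: measurable_fun_le => //; exact: measurable_funM.
have PU t : `|t| = r / 2 -> (P theta (U t) <= (expR (- (r / 2 * (x / 2) * n%:R)))%:E)%E.
  move=> tr; have [Ttt psit] := Hr theta tab t ltac:(by rewrite tr; lra).
  apply: (le_trans (chernoff_sum f0_meas f0_ge0 iid _ n Tt Ttt)).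
  rewrite lee_fin ler_expR.
  have h : psi (theta + t) - psi theta <= t * derive1 psi theta + x / 2 * `|t|.
    by rewrite -lerBlDl (le_trans (ler_norm _)).
  have := ler_wpM2l (ler0n R n) h; rewrite tr.
  by lra.
have r2 : `|r / 2| = r / 2 by rewrite gtr0_norm ?divr_gt0.
have r2N : `|- (r / 2)| = r / 2 by rewrite normrN.
rewrite [2 * _]mulr_natl [_ *+ 2]mulr2n EFinD.
apply: (@le_trans _ _ (P theta (U (r / 2) `|` U (- (r / 2))))); last first.
  apply: (le_trans (measureU2 _ _ _)) => //.
  by apply: leeD; exact: PU.
apply: le_measure; rewrite ?inE; [|exact: measurableU|].
  rewrite -[X in measurable X]setTI; apply: measurable_fun_le => //.
  by apply: measurableT_comp => //; exact: measurable_funB.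
move=> w /=; rewrite ler_normr /U/= r2 r2N => /orP[h|h]; [left|right];
  have := ler_wpM2l (ltW (divr_gt0 r0 (ltr0n R 2))) h; lra.
Qed.

Lemma mixture_lr_ge (H : probability (measurableTypeR R) R) (V : set R) n w (y : R) :
  measurable V -> V `<=` Theta ->
  (forall x, V x -> y <= (x - theta0) * \sum_(j < n) X j w
     - n%:R * (psi x - psi theta0)) ->
  ((expR y)%:E * H V <= mixture_lr psi Theta theta0 X H n w)%E.
Proof.
move=> mV VT hV.
have -> : ((expR y)%:E * H V = \int[H]_(x in Theta) (expR y * \1_V x)%:E)%E.
  have mT : measurable (Theta : set (measurableTypeR R)) by exact: open_measurable.
  under eq_integral do rewrite EFinM.
  rewrite ge0_integralZl//; last first.
    by apply/measurable_EFinP/measurable_funTS; exact: measurable_indic.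
  by rewrite integral_indic// setIidl.
apply: ge0_le_integral_nomeas => x Tx; first by rewrite lee_fin mulr_ge0 ?expR_ge0.
rewrite lee_fin indicE; have [/set_mem Vx|_] := boolP (x \in V); last first.
  by rewrite mulr0 expR_ge0.
rewrite mulr1 ler_expR (le_trans (hV _ Vx))//.
rewrite -natr_sample_mean le_eqVlt; apply/orP; left; apply/eqP; ring.
Qed.

(** When the sample mean is close to the derivative of [psi] at [theta], every parameter in [V] has
    log-likelihood ratio at least [(1 + g) * L] at a sample size slightly above [L / I]. The surplus
    [g * L] pays for the mixing mass of [V]. Each of rounding, the choice of [g] and the exceptional
    event costs at most [e / 3]. *)
Lemma run_length_upper a b C e :
  (forall x, a <= x <= b -> Theta x) -> 0 < e -> 0 < C ->
  exists eta g L0 : R, [/\ 0 < eta, 0 < g &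
    forall (alpha : R) (M : nat) (H : probability (measurableTypeR R) R)
      (V : set R) (theta : R),
    0 < alpha -> L0 <= ln alpha^-1 -> (0 < M)%N -> M%:R <= C * ln alpha^-1 ->
    a <= theta <= b -> ln alpha^-1 / M%:R <= I theta ->
    measurable V -> V `<=` Theta -> (forall x, V x -> `|x - theta| <= eta) ->
    ((expR (- (g * ln alpha^-1)))%:E <= H V)%E ->
    run_length_profile psi Theta theta0 X P H M alpha theta <=
    ln alpha^-1 / M%:R / I theta + e].
Proof.
move=> abT e0 C0; have [B B0 HB] := dist_bounded abT.
have [K K0 HK] := continuous_bounded_on abT
  (@info_continuous _ _ _ theta0 psi_derivable).
(* [g <= 1 / 2] gives [(1 + g) / (1 - g) <= 1 + 4 * g], and [g <= e / 12] makes [4 * g <= e / 3]. *)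
pose g := Num.min (1 / 2) (e / 12).
have g0 : 0 < g by rewrite lt_min; apply/andP; split; [lra|rewrite divr_gt0].
have g12 : g <= 1 / 2 by rewrite ge_min lexx.
have ge12 : g <= e / 12 by rewrite ge_min lexx orbT.
(* The deviation of the sample mean costs [(B + 1) * x] and linearizing [psi] costs [x / 2].
   Together they stay below [g / C], hence below [g * J], because [J >= L / M >= C^-1]. *)
pose x := g / C / (B + 2).
have B20 : 0 < B + 2 by lra.
have x0 : 0 < x by rewrite !divr_gt0.
have xB : (B + 2) * x = g / C by rewrite mulrC divfK// gt_eqF.
have x20 : 0 < x / 2 by rewrite divr_gt0.
have [r r0 Hr] := psi_unif_derivable Theta_open Theta_itv psi_derivable abT x20.
have [s s0 tail] := sample_mean_tail abT x0.
pose eta := Num.min 1 (r / 2).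
have eta0 : 0 < eta by rewrite lt_min ltr01 divr_gt0.
have eta1 : eta <= 1 by rewrite ge_min lexx.
have etar : eta <= r / 2 by rewrite ge_min lexx orbT.
have sK0 : 0 < s / K by rewrite divr_gt0.
have [L1 L11 HL1] := mul_expRN_small sK0 (ler0n R 2) (divr_gt0 e0 (ltr0n R 3)).
exists eta, g, (Num.max L1 (3 * K / e)); split => //.
move=> alpha M H V theta a0; rewrite ge_max => /andP[LL1 LL2] M0 MC tab cI mV VT Veta HV.
set L := ln alpha^-1 in LL1 LL2 MC cI HV *.
have L1' : 1 <= L by exact: le_trans LL1.
have L0 : 0 < L by apply: lt_le_trans L1'.
have alphaE : alpha^-1 = expR L by rewrite lnK// posrE invr_gt0.
have Mr0 : 0 < M%:R :> R by rewrite ltr0n.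
have c0 : 0 < L / M%:R by rewrite divr_gt0.
set J := I theta in cI *; have J0 : 0 < J by apply: lt_le_trans cI.
have JK : J <= K by rewrite (le_trans (ler_norm _))// HK.
have Bt := HB _ tab; have Tt := abT _ tab.
have gCJ : g / C <= g * J.
  rewrite ler_pM2l// (le_trans _ cI)// ler_pdivlMr// mulrC ler_pdivrMr//.
  by rewrite mulrC.
(* The solution of [Y * (J * (1 - g)) = (1 + g) * L]. *)
pose Y := (1 + g) / (1 - g) * (L / J).
have g1 : 0 < 1 - g by lra.
have LJ0 : 0 < L / J by rewrite divr_gt0.
have q1 : 1 <= (1 + g) / (1 - g) by rewrite ler_pdivlMr//; lra.
have q4 : (1 + g) / (1 - g) <= 1 + 4 * g by rewrite ler_pdivrMr//; nra.
have Y0 : 0 <= Y by rewrite mulr_ge0 ?(ltW LJ0)// (le_trans _ q1).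
pose n := (Num.truncn Y).+1.
have /andP[nY Yn] := truncn_itv Y0; rewrite -/n in Yn.
have nY1 : n%:R <= Y + 1 by rewrite /n -addn1 natrD lerD2r.
have n0 : 0 < n%:R :> R by rewrite ltr0n.
have LJn : L / J <= n%:R.
  by rewrite (le_trans _ (ltW Yn))// ler_peMl// ltW.
pose B' := [set w | n%:R * x <= `|\sum_(j < n) X j w - n%:R * derive1 psi theta|].
have mB' : measurable B'.
  rewrite /B' -[X in measurable X]setTI; apply: measurable_fun_le => //.
  by apply: measurableT_comp => //; apply: measurable_funB => //; exact: measurable_sum_prefix.
have PB' : fine (P theta B') <= e / 3.
  rewrite -lee_fin fineK ?fin_num_measure//.
  apply: (le_trans (tail theta n tab)); rewrite lee_fin.
  apply: le_trans (HL1 _ LL1).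
  apply: (@le_trans _ _ (2 * expR (- (s / K * L)))).
    rewrite ler_pM2l// ler_expR lerN2 -mulrA ler_pM2l// (le_trans _ LJn)//.
    by rewrite mulrC ler_pM2l// lef_pV2// posrE.
  by rewrite ler_pM2r ?expR_gt0// ler_peMr.
have nI : (1 + g) * L <= n%:R * (J - g / C).
  apply: (@le_trans _ _ (n%:R * (J * (1 - g)))); last by rewrite ler_pM2l//; lra.
  apply: (@le_trans _ _ (Y * (J * (1 - g)))).
    by rewrite /Y le_eqVlt; apply/orP; left; apply/eqP; field; rewrite !gt_eqF.
  by rewrite ler_pM2r ?mulr_gt0// ltW.
apply: (le_trans (@profile_le_of_event _ _ _ psi Theta theta0 X H M alpha P M0 theta n
   B' mB' isT _)).
  move=> w /negP; rewrite -ltNge => Sw.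
  apply: (@le_trans _ _ ((expR ((1 + g) * L))%:E * H V)%E); last first.
    apply: mixture_lr_ge => // y Vy; apply: (le_trans nI).
    have yt := Veta _ Vy.
    pose t := y - theta; have ytE : y = theta + t by rewrite /t; ring.
    have tr : `|t| < r by rewrite (le_lt_trans yt)//; lra.
    have [_ psit] := Hr theta tab t tr; rewrite -ytE in psit.
    pose D := \sum_(j < n) X j w - n%:R * derive1 psi theta.
    rewrite (_ : \sum_(j < n) X j w = n%:R * derive1 psi theta + D); last first.
      by rewrite /D; ring.
    have yB : `|y - theta0| <= B + 1.
      rewrite (_ : y - theta0 = (theta - theta0) + t); last by rewrite ytE; ring.
      by rewrite (le_trans (ler_normD _ _))// lerD// (le_trans yt).
    have hD : - ((B + 1) * (n%:R * x)) <= (y - theta0) * D.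
      have : `|(y - theta0) * D| <= (B + 1) * (n%:R * x).
        by rewrite normrM ler_pM// ltW.
      by rewrite ler_norml => /andP[].
    have hpsi : psi y - psi theta <= t * derive1 psi theta + x / 2.
      rewrite -lerBlDl (le_trans (ler_norm _))// (le_trans psit)// ler_piMr ?(ltW x20)//.
      exact: le_trans yt eta1.
    have := ler_wpM2l (ler0n R n) hpsi.
    have hx : n%:R * (g / C) = n%:R * ((B + 1) * x) + n%:R * (x / 2) + n%:R * (x / 2).
      by rewrite -xB; field.
    have nx : 0 <= n%:R * (x / 2) by rewrite mulr_ge0// ltW.
    have E1 : (y - theta0) * (n%:R * derive1 psi theta + D) =
        n%:R * ((theta - theta0) * derive1 psi theta) +
        n%:R * (t * derive1 psi theta) + (y - theta0) * D by rewrite /t; ring.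
    by rewrite (mulrBr n%:R J) hx E1 /J /info; lra.
  rewrite alphaE -[in leLHS](addrK (g * L) L) (_ : L + g * L = (1 + g) * L); last by ring.
  by rewrite expRD EFinM lee_wpmul2l// lee_fin expR_ge0.
have cJ1 : L / M%:R / J <= 1 by rewrite ler_pdivrMr// mul1r.
have cJ0 : 0 <= L / M%:R / J by rewrite divr_ge0 ?ltW.
have YM : Y / M%:R <= L / M%:R / J + 4 * g.
  have -> : Y / M%:R = (1 + g) / (1 - g) * (L / M%:R / J).
    by rewrite /Y; field; rewrite !gt_eqF.
  by have := ler_wpM2r cJ0 q4; nra.
(* [L / M <= J <= K] forces [M] to grow with [L], so rounding [Y] up is negligible relative to
   [M]. *)
have M1 : 1 / M%:R <= e / 3.
  apply: (@le_trans _ _ (K / L)).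
    rewrite ler_pdivlMr// mul1r mulrC (le_trans cI)//.
  rewrite ler_pdivrMr//; move: LL2; rewrite ler_pdivrMr//; lra.
have : n%:R / M%:R <= Y / M%:R + 1 / M%:R by rewrite -mulrDl ler_pM2r ?invr_gt0.
by lra.
Qed.

End run_length_bounds.

(** * Average run length *)

Section good_cells.
Context (R : realType).
Implicit Types (G : probability (measurableTypeR R) R).
Local Notation leb := (@lebesgue_measure R).

(** Radon-Nikodym, followed by the absolute continuity of the integral of the derivative. *)
Lemma abs_continuous_eps G e : G `<< leb -> 0 < e ->
  exists2 t : R, 0 < t & forall V : set R, measurable V ->
    (leb V < t%:E)%E -> (G V < e%:E)%E.
Proof.
move=> Gac e0.
pose f x : R := fine (Radon_Nikodym_SigmaFinite.f G leb x).
have fE x : Radon_Nikodym_SigmaFinite.f G leb x = (f x)%:E.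
  by rewrite /f fineK// Radon_Nikodym_SigmaFinite.f_fin_num.
have f0 x : 0 <= f x by rewrite fine_ge0// Radon_Nikodym_SigmaFinite.f_ge0.
have intf : leb.-integrable setT (EFin \o f).
  apply: eq_integrable (Radon_Nikodym_SigmaFinite.f_integrable Gac) => // x _.
have [t [t0 Ht]] := integral_normr_continuous intf e0.
exists t => // V mV /(Ht _ mV).
have GVE : G V = (\int[leb]_(x in V) (`|f x|)%:E)%E.
  rewrite (Radon_Nikodym_SigmaFinite.f_integral Gac mV).
  by apply: eq_integral => x _; rewrite fE ger0_norm.
by rewrite /Rintegral -GVE -lte_fin fineK// fin_num_measure.
Qed.

Lemma interval_cells (a b eta : R) : 0 < eta ->
  exists N : nat, forall x, a <= x <= b ->
    exists2 i, (i < N)%N & a + i%:R * eta <= x < a + i.+1%:R * eta.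
Proof.
move=> eta0; exists (Num.truncn ((b - a) / eta)).+1 => x /andP[ax xb].
have x0 : 0 <= (x - a) / eta by rewrite divr_ge0 ?subr_ge0// ltW.
have /andP[n1 n2] := truncn_itv x0.
exists (Num.truncn ((x - a) / eta)).
  rewrite ltnS; apply: le_truncn; rewrite ler_pM2r ?invr_gt0// lerD2r//.
by rewrite -lerBrDl -ltrBlDl -ler_pdivlMr// -ltr_pdivrMr// n1.
Qed.

(* Points of A whose cell meets Q in a Lebesgue-small set have small G-mass,
   because G is absolutely continuous and there are finitely many cells. *)
Lemma good_cells G (a b eta e : R) : G `<< leb -> 0 < eta -> 0 < e ->
  exists2 t : R, 0 < t & forall A Q : set R, measurable A -> measurable Q ->
    (forall x, A x -> a <= x <= b) -> Q `<=` A -> (G (A `\` Q) <= e%:E)%E ->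
    exists2 Bad : set R, measurable Bad /\ (G Bad <= (2 * e)%:E)%E &
      forall x, A x -> ~ Bad x ->
        (t%:E <= leb (Q `&` [set y : R | (`|y - x| <= eta)%R]))%E.
Proof.
move=> Gac eta0 e0; have [N cells] := interval_cells a b eta0.
(* The share of [e] allotted to each cell; the successor avoids a division by 0. *)
have eN0 : 0 < e / N.+1%:R by rewrite divr_gt0.
have [t t0 Ht] := abs_continuous_eps Gac eN0.
(* [t] is fixed before [A] and [Q], hence common to all densities and all [alpha]. *)
exists t => // A Q mA mQ Aab QA GAQ.
pose J i := [set` `[a + i%:R * eta, a + i.+1%:R * eta[ ] : set R.
have mJ i : measurable (J i) by exact: measurable_itv.
pose bad i := (leb (Q `&` J i) < t%:E)%E.
pose Bad := (A `\` Q) `|` \big[setU/set0]_(i < N | bad i) (Q `&` J i).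
have mQJ i : measurable (Q `&` J i) by exact: measurableI.
have mbig : measurable (\big[setU/set0]_(i < N | bad i) (Q `&` J i)).
  by apply: bigsetU_measurable => i _.
exists Bad.
  split; first by apply: measurableU => //; exact: measurableD.
  apply: (le_trans (measureU2 _ _ _)) => //; first exact: measurableD.
  rewrite mulr_natl mulr2n EFinD leeD//.
  apply: (@le_trans _ _ (\sum_(i < N) (e / N.+1%:R)%:E)%E); last first.
    rewrite sumEFin lee_fin sumr_const card_ord -[_ *+ N]mulr_natl.
    rewrite (_ : N%:R * (e / N.+1%:R) = e * (N%:R / N.+1%:R)); last by ring.
    rewrite ler_piMr ?(ltW e0)//.
    by rewrite ler_pdivrMr// mul1r ler_nat.
  rewrite big_mkcond/=.
  apply: (@le_trans _ _ (\sum_(i < N) G (if bad i then Q `&` J i else set0))%E).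
    have mF i : measurable ((if bad i then Q `&` J i else set0) : set (measurableTypeR R)).
      by case: ifP => _; [exact: mQJ|exact: measurable0].
    exact: (@Boole_inequality _ _ (measurableTypeR R) G
      (fun i => if bad i then Q `&` J i else set0) N (fun i _ => mF i)).
  apply: lee_sum => i _; case: ifPn => [bi|_]; first exact/ltW/Ht.
  by rewrite measure0 lee_fin ltW.
move=> x Ax Bx; have [i iN xi] := cells x (Aab x Ax).
have Qx : Q x by apply: contrapT => nQ; apply: Bx; left.
have nbad : ~~ bad i.
  apply/negP => bi; apply: Bx; right.
  rewrite big_mkcond/= -(bigcup_mkord N (fun i => if bad i then Q `&` J i else set0)).
  by exists i => //=; rewrite bi; split => //; rewrite /J /= in_itv.
move: nbad; rewrite /bad -leNgt => /le_trans; apply.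
have mball : measurable [set y : R | `|y - x| <= eta].
  rewrite -[X in measurable X]setTI; apply: measurable_fun_le => //.
  by apply: measurableT_comp => //; exact: measurable_funB.
apply: le_measure; [by rewrite inE; exact: mQJ|by rewrite inE; exact: measurableI|].
move=> y [Qy]; rewrite /J /= in_itv/= => /andP[y1 y2]; split => //=.
move: xi => /andP[x1 x2].
rewrite ler_norml; move: y2 x2; rewrite -natr1 mulrDl mul1r => y2 x2.
by apply/andP; split; lra.
Qed.

End good_cells.

Lemma near_ln_inv (R : realType) (L0 : R) :
  \forall alpha \near (0 : R)^'+, 0 < alpha /\ L0 <= ln alpha^-1.
Proof.
near=> alpha.
have a0 : 0 < alpha by near: alpha; exact: nbhs_right_gt.
split=> //.
have aL : alpha < expR (- L0).
  by near: alpha; apply: nbhs_right_lt; exact: expR_gt0.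
rewrite lnV ?posrE// lerNr -[leRHS]expRK ler_ln ?posrE ?expR_gt0//.
exact: ltW.
Unshelve. all: end_near. Qed.

(** [K n] keeps the points of size at most [n] with a margin of 1/(n+1) inside [Theta]. These
    intervals increase to [Theta], and the margin brings their infimum and supremum back into
    [Theta], so the closed segment between them is admissible. *)
Lemma compact_exhaustion (R : realType) (G : probability (measurableTypeR R) R)
    (Theta : set R) (e : R) :
  open Theta -> is_interval Theta -> Theta !=set0 -> 0 < e ->
  exists a b : R, (forall x, a <= x <= b -> Theta x) /\
    (G (Theta `\` [set` `[a, b]]) <= e%:E)%E.
Proof.
move=> oT iT [z Tz] e0.
have mT : measurable (Theta : set (measurableTypeR R)) by exact: open_measurable.
pose K (n : nat) : set R := [set x : R | `|x| <= n%:R /\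
  forall y : R, `|y - x| < n.+1%:R^-1 -> Theta y].
have Kitv n : is_interval (K n).
  move=> x y [xn Kx] [yn Ky] w /andP[xw wy]; split.
    rewrite ler_norml; move: xn yn; rewrite !ler_norml => /andP[? ?] /andP[? ?].
    by apply/andP; split; lra.
  move=> v vw; apply: (iT (x + (v - w)) (y + (v - w))).
  - by apply: Kx; rewrite addrAC subrr add0r.
  - by apply: Ky; rewrite addrAC subrr add0r.
  - by apply/andP; split; lra.
have mK n : measurable (K n : set (measurableTypeR R)) by exact: is_interval_measurable.
have KT n : K n `<=` Theta.
  by move=> x [_]; apply; rewrite subrr normr0 invr_gt0.
have Kn n m : (n <= m)%N -> K n `<=` K m.
  move=> nm x [xn Kx]; split; first by rewrite (le_trans xn)// ler_nat.
  move=> y yx; apply: Kx; apply: lt_le_trans yx _.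
  by rewrite lef_pV2 ?posrE// ler_nat.
have Kcup x : Theta x -> exists n, K n x.
  move=> Tx; have [r r0 Hr] := open_interval_widen oT Tx.
  pose n := (Num.truncn `|x|).+1; pose m := (Num.truncn r^-1).+1.
  exists (maxn n m); split.
    rewrite (@le_trans _ _ n%:R) ?ler_nat ?leq_maxl//.
    by have /andP[_ /ltW] := truncn_itv (normr_ge0 x).
  move=> y yx; apply: Hr; apply: lt_le_trans yx _.
  rewrite -[leRHS]invrK lef_pV2 ?posrE ?invr_gt0//.
  rewrite (@le_trans _ _ m%:R) ?ler_nat ?leqW ?leq_maxr//.
  have ri : 0 <= r^-1 by rewrite invr_ge0 ltW.
  by have /andP[_ /ltW] := truncn_itv ri.
pose D n : set (measurableTypeR R) := (Theta : set (measurableTypeR R)) `\` K n.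
have mD n : measurable (D n) by exact: measurableD.
have D0 : \bigcap_n D n = set0.
  apply/seteqP; split => // x Dx; have [Tx _] := Dx 0%N I.
  by have [n Knx] := Kcup x Tx; have [_] := Dx n I; apply.
have GD : G (D n) @[n --> \oo] --> 0%E.
  rewrite -(measure0 G) -D0; apply: nonincreasing_cvg_mu => //.
  - by rewrite ltey_eq fin_num_measure.
  - by rewrite D0.
  - move=> n m nm; apply/subsetPset => x [Tx Kx]; split => // Knx.
    by apply: Kx; exact: Kn nm x Knx.
(* A large index that also captures [z], so that [K n] is nonempty and has an infimum and a
   supremum. *)
have [n Gn Kz] : exists2 n, (G (D n) < e%:E)%E & K n z.
  have [n0 Kn0z] := Kcup z Tz.
  have ev : \forall n \near \oo, (G (D n) < e%:E)%E.
    have eN : nbhs (0%E : \bar R) [set x | (x < e%:E)%E] by exact: lt_nbhsl.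
    exact: GD _ eN.
  have [N _ HN] := ev.
  exists (maxn N n0); first by apply: HN => /=; rewrite leq_maxl.
  by apply: (Kn n0 _ _ z Kn0z); rewrite leq_maxr.
have Kub : has_sup (K n).
  by split; [exists z|exists n%:R => x [/ler_normlP[_ ? _]]].
have Klb : has_inf (K n).
  by split; [exists z|exists (- n%:R) => x [/ler_normlP[? _ _]]; rewrite lerNl].
have n10 : 0 < n.+1%:R^-1 :> R by rewrite invr_gt0.
have Ta : Theta (inf (K n)).
  have [x Kx xi] := inf_adherent n10 Klb; apply: Kx.2.
  have ix : inf (K n) <= x by have := ge_inf Klb.2 Kx.
  by rewrite ler0_norm ?subr_le0// opprB ltrBlDl.
have Tb : Theta (sup (K n)).
  have [x Kx xi] := sup_adherent n10 Kub; apply: Kx.2.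
  have xs : x <= sup (K n) by have := ub_le_sup Kub.2 Kx.
  by rewrite ger0_norm ?subr_ge0// ltrBlDr addrC -ltrBlDr.
exists (inf (K n)), (sup (K n)); split.
  by move=> x; exact: (iT _ _ Ta Tb).
apply: le_trans (ltW Gn); apply: le_measure; rewrite ?inE//.
  by apply: measurableD => //; exact: measurable_itv.
move=> x [Tx xab]; split => // Kx; apply: xab.
by rewrite /= in_itv/= ge_inf ?ub_le_sup//; [case: Kub|case: Klb].
Qed.

(** * Uniform remainders for tame selections of mixing densities *)

Section remainder.
Context (R : realType) (d : measure_display) (Omega : measurableType d).
Context (mu : {sigma_finite_measure set (measurableTypeR R) -> \bar R}).
Context (f0 psi : R -> R) (Theta : set R) (theta0 : R).
Context (P : R -> probability Omega R) (X : nat -> {mfun Omega >-> R}).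
Context (G : probability (measurableTypeR R) R).
Hypothesis f0_meas : measurable_fun [set: measurableTypeR R] f0.
Hypothesis f0_ge0 : forall x, 0 <= f0 x.
Hypothesis Theta_open : open Theta.
Hypothesis Theta_itv : is_interval Theta.
Hypothesis Theta0 : Theta theta0.
Hypothesis iid : iid_expfam mu f0 psi Theta P X.
Hypothesis psi_derivable : forall theta, Theta theta ->
  derivable psi theta 1 /\ derivable (derive1 psi) theta 1.
Hypothesis G_Theta : G Theta = 1%E.
Hypothesis G_ac : G `<< lebesgue_measure.
Context (I : Type) (Gamma : set I) (h : I -> R -> R).
Context (H : I -> probability (measurableTypeR R) R) (M : R -> nat) (C : R).
Hypothesis mixH : mixing_family Theta Gamma h H.
Hypothesis M_gt0 : forall alpha, (0 < M alpha)%N.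
Hypothesis C_gt0 : 0 < C.
Hypothesis M_le : \forall alpha \near 0^'+, (M alpha)%:R <= C * ln alpha^-1.

Local Notation J := (info psi ^~ theta0).
Local Notation cut alpha := (ln alpha^-1 / (M alpha)%:R).
Local Notation avg g alpha := (avg_run_length psi Theta theta0 X P G g (M alpha) alpha).
Local Notation profile g alpha := (run_length_profile psi Theta theta0 X P g (M alpha) alpha).

Let mT : measurable (Theta : set (measurableTypeR R)).
Proof. exact: open_measurable. Qed.

Let measurable_on (f : R -> R) :
  (forall x, Theta x -> {for x, continuous f}) ->
  measurable_fun (Theta : set (measurableTypeR R)) f.
Proof. exact: measurable_continuous_on. Qed.

Let mJ : measurable_fun (Theta : set (measurableTypeR R)) J.
Proof. by apply: measurable_on => x Tx; exact: (info_continuous psi_derivable). Qed.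

Let target alpha x : R := cut alpha / Num.max (cut alpha) (J x).

Let mtarget alpha : 0 < cut alpha ->
  measurable_fun (Theta : set (measurableTypeR R)) (target alpha).
Proof.
move=> c0; apply: measurable_on => x Tx.
have cJ := @info_continuous _ _ _ theta0 psi_derivable x Tx.
rewrite /target; apply: cvgM; first exact: cvg_cst.
apply: cvgV; first by rewrite gt_eqF// lt_max c0.
under eq_fun do rewrite maxr_absE; rewrite maxr_absE.
apply: cvgM; last exact: cvg_cst.
apply: cvgD; first by apply: cvgD => //; exact: cvg_cst.
by apply: cvg_norm; apply: cvgB => //; exact: cvg_cst.
Qed.

Lemma fin_integral_profile g alpha :
  (\int[G]_(x in Theta) (profile g alpha x)%:E)%E \is a fin_num.
Proof.
rewrite ge0_fin_numE; last first.
  by apply: integral_ge0 => x _; rewrite lee_fin profile_ge0.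
apply: (@le_lt_trans _ _ (\int[G]_(x in Theta) (cst 1%:E x))%E).
  apply: ge0_le_integral_nomeas => x _ /=; rewrite lee_fin; first exact: profile_ge0.
  exact: profile_le1.
by rewrite integral_cst// mul1e [X in (X < _)%E]G_Theta ltry.
Qed.

Lemma EFin_avg_run_length g alpha :
  ((avg g alpha)%:E = \int[G]_(x in Theta) (profile g alpha x)%:E)%E.
Proof. by rewrite /avg_run_length /Rintegral fineK// fin_integral_profile. Qed.

Lemma avg_run_length_ge0 g alpha : 0 <= avg g alpha.
Proof. by apply: Rintegral_ge0 => x _; exact: profile_ge0. Qed.

Lemma avg_run_length_le1 g alpha : avg g alpha <= 1.
Proof.
rewrite -lee_fin EFin_avg_run_length.
apply: (@le_trans _ _ (\int[G]_(x in Theta) (cst 1%:E x))%E).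
  apply: ge0_le_integral_nomeas => x _ /=; rewrite lee_fin; first exact: profile_ge0.
  exact: profile_le1.
by rewrite integral_cst// mul1e [X in (X <= _)%E]G_Theta.
Qed.

(* The profiles need not be measurable in theta: they are compared through the
   measurable first-order limit min(1, log(1/alpha) / (M I)). *)
Lemma avg_run_length_le (g g' : probability (measurableTypeR R) R) alpha a b e
    (Bad : set R) :
  0 < e -> (forall x, a <= x <= b -> Theta x) ->
  (G (Theta `\` [set` `[a, b]]) <= e%:E)%E ->
  measurable Bad -> (G Bad <= (2 * e)%:E)%E -> 0 < cut alpha ->
  (forall x, a <= x <= b -> ~ Bad x -> profile g alpha x <= target alpha x + e) ->
  (forall x, a <= x <= b -> target alpha x - e <= profile g' alpha x) ->
  avg g alpha <= avg g' alpha + 6 * e.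
Proof.
move=> e0 abT Gab mBad GBad c0 upper lower.
pose Out := Theta `\` [set` `[a, b]] : set (measurableTypeR R).
have mOut : measurable Out by apply: measurableD => //; exact: measurable_itv.
(* A measurable minorant of the profile of [g']: since the target is at most 1, the indicator brings
   it down to 0 on [Out], where no lower bound is available. *)
pose l x := Num.max 0 (target alpha x - e - \1_Out x).
have l0 x : 0 <= l x by rewrite le_max lexx.
have ml : measurable_fun (Theta : set (measurableTypeR R)) l.
  apply: (measurable_maxr (f := cst 0)) => //; apply: measurable_funB.
    by apply: measurable_funB => //; exact: mtarget.
  by apply/measurable_funTS; exact: measurable_indic.
(* The price of passing from [l] to the profile of [g]: twice [e] at good points, and enough to
   cover the trivial bound 1 on [Out] and [Bad]. Each of the three terms integrates to at most
   [2 * e]. *)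
pose k x : R := 2 * e + 2 * \1_Out x + \1_Bad x.
have k0 x : 0 <= k x by rewrite !addr_ge0// mulr_ge0// ltW.
have mk : measurable_fun (Theta : set (measurableTypeR R)) k.
  apply: measurable_funTS; apply: measurable_funD; last exact: measurable_indic.
  by apply: measurable_funD => //; apply: measurable_funM.
have t0 x : 0 <= target alpha x.
  by rewrite divr_ge0 ?(ltW c0)// le_max (ltW c0).
have t1 x : target alpha x <= 1.
  by rewrite ler_pdivrMr ?mul1r ?le_max ?lexx// lt_max c0.
have in1 (A : set R) x : A x -> \1_A x = 1 :> R.
  by move=> Ax; rewrite indicE mem_set.
have in0 (A : set R) x : ~ A x -> \1_A x = 0 :> R.
  by move=> Ax; rewrite indicE memNset.
have h1 x : Theta x -> profile g alpha x <= l x + k x.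
  move=> Tx; have [Ox|Ox] := pselect (Out x).
    apply: (@le_trans _ _ 1); first exact: profile_le1.
    have : \1_Bad x >= 0 :> R by [].
    have := l0 x; rewrite /k (in1 _ _ Ox).
    lra.
  have xab : a <= x <= b.
    have [xab|xab] := pselect ([set` `[a, b]] x); first by move: xab; rewrite /= in_itv.
    by exfalso; apply: Ox.
  have [Bx|Bx] := pselect (Bad x).
    apply: (@le_trans _ _ 1); first exact: profile_le1.
    have : \1_Out x >= 0 :> R by [].
    have := l0 x; rewrite /k (in1 _ _ Bx).
    lra.
  have := upper x xab Bx.
  have : target alpha x - e - \1_Out x <= l x by rewrite le_max lexx orbT.
  have : \1_Bad x >= 0 :> R by [].
  rewrite /k (in0 _ _ Ox); lra.
have h2 x : Theta x -> l x <= profile g' alpha x.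
  move=> Tx; rewrite ge_max profile_ge0//=.
  have [Ox|Ox] := pselect (Out x).
    rewrite (in1 _ _ Ox); apply: le_trans (profile_ge0 psi Theta theta0 X g' alpha P (M_gt0 alpha) x).
    by have := t1 x; lra.
  have xab : a <= x <= b.
    have [xab|xab] := pselect ([set` `[a, b]] x); first by move: xab; rewrite /= in_itv.
    by exfalso; apply: Ox.
  by have := lower x xab; rewrite (in0 _ _ Ox) subr0.
have le_fin_of (u v : R) (U V : \bar R) : u%:E = U -> v%:E = V ->
    (U <= V + (6 * e)%:E)%E -> u <= v + 6 * e.
  by move=> <- <-; rewrite -EFinD lee_fin.
apply: (le_fin_of _ _ _ _ (EFin_avg_run_length g alpha) (EFin_avg_run_length g' alpha)).
clear le_fin_of.
apply: (@le_trans _ _ (\int[G]_(x in Theta) ((l x)%:E + (k x)%:E))%E).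
  apply: ge0_le_integral_nomeas => x Tx; first by rewrite lee_fin profile_ge0.
  by rewrite -EFinD lee_fin h1.
have l0E x : Theta x -> (0 <= (l x)%:E)%E by move=> _; rewrite lee_fin.
have k0E x : Theta x -> (0 <= (k x)%:E)%E by move=> _; rewrite lee_fin.
have /measurable_EFinP mlE := ml; have /measurable_EFinP mkE := mk.
rewrite (ge0_integralD _ mT l0E mlE k0E mkE).
apply: leeD.
  by apply: ge0_le_integral_nomeas => x Tx; rewrite lee_fin ?h2.
have -> : (\int[G]_(x in Theta) (k x)%:E =
    (2 * e)%:E * G Theta + 2%:E * G Out + G (Bad `&` Theta))%E.
  have mI (A : set (measurableTypeR R)) : measurable A -> measurable_fun
      (Theta : set (measurableTypeR R)) (fun x => (\1_A x : R)%:E).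
    by move=> mA; apply/measurable_EFinP/measurable_funTS; exact: measurable_indic.
  transitivity (\int[G]_(x in Theta)
    ((2 * e)%:E + 2%:E * (\1_Out x)%:E + (\1_Bad x)%:E))%E.
    exact: eq_integral.
  rewrite ge0_integralD//; [|by move=> x _; rewrite -EFinM -EFinD lee_fin addr_ge0// mulr_ge0// ltW| |exact: mI].
    rewrite ge0_integralD//; [|by move=> x _; rewrite lee_fin mulr_ge0// ltW| ].
      rewrite integral_cst// ge0_integralZl//; last exact: mI.
      by rewrite !integral_indic// setIidl//; move=> x [].
    by apply: emeasurable_funM => //; exact: mI.
  apply: emeasurable_funD => //.
  by apply: emeasurable_funM => //; exact: mI.
rewrite G_Theta mule1 (_ : 6 * e = 2 * e + 2 * e + 2 * e); last by ring.
rewrite !EFinD leeD//; last first.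
  apply: le_trans GBad; apply: le_measure; rewrite ?inE//; exact: measurableI.
apply: leeD => //.
have : (2%:E * G Out <= 2%:E * e%:E)%E by apply: lee_wpmul2l.
by rewrite -EFinM.
Qed.


(* [tame S]: up to small G-mass, the densities selected at alpha are not
   exponentially small (in log (1/alpha)) on compact parts of A(M, alpha). *)
Definition tame (S : R -> I -> Prop) : Prop :=
  forall a b e dl : R, (forall x, a <= x <= b -> Theta x) -> 0 < e -> 0 < dl ->
  \forall alpha \near 0^'+, forall gs, S alpha gs ->
    (G [set x : R | [/\ (a <= x <= b)%R, (cut alpha <= J x)%R &
        (h gs x < expR (- (e * ln alpha^-1)))%R]] <= dl%:E)%E.

(** Half of the rate [g] allowed by [run_length_upper] is spent on the size of the density on [Q],
    the other half on the Lebesgue mass [t] of a neighbourhood within [Q]. The lower bound holds for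
    every mixing distribution, so the competitor [g'] is arbitrary. *)
Lemma tame_optimal S : (forall alpha gs, S alpha gs -> Gamma gs) -> tame S ->
  forall e, 0 < e -> \forall alpha \near 0^'+, forall gs, S alpha gs ->
    forall g', avg (H gs) alpha <= avg g' alpha + e.
Proof.
move=> SG tS e0' e0'_gt0; pose e := e0' / 6.
have e0 : 0 < e by rewrite divr_gt0.
have [a [b [abT Gab]]] := compact_exhaustion G Theta_open Theta_itv
  (ex_intro _ theta0 Theta0) e0.
have [L1 lower] := run_length_lower theta0 f0_meas f0_ge0 Theta_open Theta_itv iid
  psi_derivable abT (divr_gt0 e0 (ltr0n R 2)) (ltW C_gt0).
have [eta [g [L2 [eta0 g0 upper]]]] := run_length_upper theta0 f0_meas f0_ge0
  Theta_open Theta_itv iid psi_derivable abT e0 C_gt0.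
have [t t0 cells] := good_cells a b G_ac eta0 e0.
have g20 : 0 < g / 2 by rewrite divr_gt0.
near=> alpha => gs Sgs g'.
have [h_gt0 h_cont Hh] := mixH (SG _ _ Sgs).
have MC : (M alpha)%:R <= C * ln alpha^-1 by near: alpha.
have [a0 L10] : 0 < alpha /\ 1 <= ln alpha^-1 by near: alpha; exact: near_ln_inv.
have [_ LL1] : 0 < alpha /\ L1 <= ln alpha^-1 by near: alpha; exact: near_ln_inv.
have [_ LL2] : 0 < alpha /\ L2 <= ln alpha^-1 by near: alpha; exact: near_ln_inv.
have [_ Lt] : 0 < alpha /\ - ln t / (g / 2) <= ln alpha^-1.
  by near: alpha; exact: near_ln_inv.
have L0 : 0 < ln alpha^-1 by apply: lt_le_trans L10.
have c0 : 0 < cut alpha by rewrite divr_gt0// ltr0n.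
pose A := [set x : R | a <= x <= b /\ cut alpha <= J x].
pose Q := [set x : R | A x /\ expR (- (g / 2 * ln alpha^-1)) <= h gs x].
have mab : measurable [set x : R | a <= x <= b].
  have -> : [set x : R | a <= x <= b] = [set` `[a, b]].
    by apply/seteqP; split => x /=; rewrite in_itv.
  exact: measurable_itv.
have abTheta : [set x : R | a <= x <= b] `<=` Theta by move=> x; exact: abT.
have mA : measurable A.
  have -> : A = [set x : R | a <= x <= b] `&` [set x | cut alpha <= J x].
    by apply/seteqP; split => x.
  apply: measurable_fun_le => //; exact: measurable_funS mT abTheta mJ.
have mh : measurable_fun (Theta : set (measurableTypeR R)) (h gs) by exact: measurable_on.
have AT : A `<=` Theta by move=> x [/abT].
have mQ : measurable Q.
  have -> : Q = A `&` [set x | expR (- (g / 2 * ln alpha^-1)) <= h gs x].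
    by apply/seteqP; split => x.
  apply: measurable_fun_le => //; exact: measurable_funS mT AT mh.
have QA : Q `<=` A by move=> x [].
have GAQ : (G (A `\` Q) <= e%:E)%E.
  have -> : A `\` Q = [set x | [/\ a <= x <= b, cut alpha <= J x &
        (h gs x < expR (- (g / 2 * ln alpha^-1)))%R]].
    apply/seteqP; split => x.
      move=> [[xab cx] Qx]; split => //; rewrite ltNge; apply/negP => hx.
      by apply: Qx.
    by move=> [xab cx hx]; split => // -[_]; rewrite leNgt hx.
  move: gs Sgs {h_gt0 h_cont Hh Q mh mQ QA}; near: alpha; exact: tS.
have Aab x : A x -> a <= x <= b by case.
have [Bad [mBad GBad] HBad] := cells A Q mA mQ Aab QA GAQ.
have -> : e0' = 6 * e by rewrite /e; field.
apply: (@avg_run_length_le _ _ alpha a b e Bad) => //; last first.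
  move=> x xab; rewrite /target.
  have e2 : 2 * (e / 2) = e by field.
  by have := lower alpha (M alpha) g' x a0 LL1 (M_gt0 alpha) MC xab; rewrite e2.
move=> x xab Bx; rewrite /target.
(* Below the cut the target is 1, and no profile exceeds 1. *)
have [cJ|Jc] := leP (cut alpha) (J x); last first.
  rewrite divff ?gt_eqF// (le_trans (profile_le1 _ _ _ _ _ _ _ _ _))// lerDl ltW//.
pose V := Q `&` [set y : R | `|y - x| <= eta].
have mV : measurable V.
  apply: measurableI => //; rewrite -[X in measurable X]setTI.
  apply: measurable_fun_le => //; apply: measurableT_comp => //.
  exact: measurable_funB.
have VT : V `<=` Theta by move=> y [/QA/AT].
have lebV := HBad x (conj xab cJ) Bx.
apply: (upper alpha (M alpha) (H gs) V x) => //.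
  by move=> y [].
rewrite Hh// setIidl//.
apply: (@le_trans _ _ (\int[lebesgue_measure]_(y in V)
    (cst (expR (- (g / 2 * ln alpha^-1)))%:E y))%E); last first.
  apply: ge0_le_integral_nomeas => y [[Ay hy] _] /=; rewrite lee_fin//.
rewrite integral_cst//.
apply: (@le_trans _ _ ((expR (- (g / 2 * ln alpha^-1)))%:E * t%:E)%E); last first.
  by rewrite lee_wpmul2l// lee_fin expR_ge0.
rewrite -EFinM lee_fin -[t]lnK ?posrE// -expRD ler_expR.
by move: Lt; rewrite ler_pdivrMr//; lra.
Unshelve. all: end_near. Qed.

(* The remainder is the worst excess over all selected candidates. *)
Lemma tame_remainder S : (forall alpha gs, S alpha gs -> Gamma gs) -> tame S ->
  exists2 r : R -> R, r alpha @[alpha --> 0^'+] --> (0 : R) &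
    forall alpha gs, S alpha gs -> forall g',
      avg (H gs) alpha <= avg g' alpha + r alpha.
Proof.
move=> SG tS.
(* The value 0 keeps the set nonempty when nothing is selected at [alpha], and makes the supremum
   nonnegative. *)
pose E alpha := [set y : R | y = 0 \/ exists gs g', S alpha gs /\
  y = avg (H gs) alpha - avg g' alpha].
have E1 alpha y : E alpha y -> y <= 1.
  move=> [->//|[gs [g' [_ ->]]]].
  by rewrite lerBlDr (le_trans (avg_run_length_le1 _ _))// lerDl avg_run_length_ge0.
have Esup alpha : has_sup (E alpha).
  by split; [exists 0; left|exists 1 => y /E1].
have E0 alpha : 0 <= sup (E alpha).
  have E00 : E alpha 0 by left.
  by have := ub_le_sup (Esup alpha).2 E00.
exists (fun alpha => sup (E alpha)).
  apply/cvgrPdist_le => e e0.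
  have := tame_optimal SG tS e0; apply: filterS => alpha Ha.
  rewrite sub0r normrN ger0_norm//; apply: ge_sup; first by exists 0; left.
  move=> y [->|[gs [g' [Sgs ->]]]]; first exact: ltW.
  by rewrite lerBlDl; exact: Ha.
move=> alpha gs Sgs g'; rewrite -lerBlDl.
have Ey : E alpha (avg (H gs) alpha - avg g' alpha) by right; exists gs, g'.
by have := ub_le_sup (Esup alpha).2 Ey.
Qed.

(** The exceptional set is empty as soon as [expR (- (e * L))] is at most the lower bound [m] on the
    segment. *)
Lemma tame_locally_bounded (K : set I) : K `<=` Gamma ->
  locally_bounded_below Theta h K -> tame (fun=> K).
Proof.
move=> KG lb a b e dl abT e0 dl0.
have [m m0 Hm] : exists2 m : R, 0 < m & forall g x, K g -> a <= x <= b -> m <= h g x.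
  have [|m m0 Hm] := lb [set` `[a, b]] (@segment_compact _ a b).
    by move=> x; rewrite /= in_itv/=; exact: abT.
  by exists m => // g x Kg xab; apply: Hm => //; rewrite /= in_itv.
near=> alpha => gs Kgs.
have [a0 L0] : 0 < alpha /\ - ln m / e <= ln alpha^-1 by near: alpha; exact: near_ln_inv.
rewrite (_ : [set x | _] = set0) ?measure0 ?lee_fin ?(ltW dl0)//.
apply/seteqP; split => // x [xab _]; rewrite ltNge => /negP; apply.
apply: le_trans (Hm _ _ Kgs xab); rewrite -[leRHS]lnK ?posrE// ler_expR.
by move: L0; rewrite ler_pdivrMr//; lra.
Unshelve. all: end_near. Qed.

Lemma locally_bounded_below1 gs : Gamma gs -> locally_bounded_below Theta h [set gs].
Proof.
move=> /mixH[h0 hc _] K cK KT.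
have [->|K0] := eqVneq K set0; first by exists 1.
have cnK : {within K, continuous (h gs)}.
  by apply: continuous_in_subspaceT => x /set_mem /KT; exact: hc.
have [c Kc Hc] := compact_EVT_min ((set0P K).1 K0) cK cnK.
exists (h gs c); first by apply: h0; apply: KT; exact: set_mem.
by move=> _ x -> Kx; apply: Hc; exact: mem_set.
Qed.

End remainder.

(** * Finite entropy *)

Section information_shell.
Context (R : realType) (psi : R -> R) (Theta : set R) (theta0 : R).
Hypothesis Theta_open : open Theta.
Hypothesis Theta_itv : is_interval Theta.
Hypothesis Theta0 : Theta theta0.
Hypothesis psi_derivable : forall theta, Theta theta ->
  derivable psi theta 1 /\ derivable (derive1 psi) theta 1.
Hypothesis psi''_gt0 : forall theta, Theta theta -> 0 < derive1 (derive1 psi) theta.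
Local Notation J := (info psi ^~ theta0).

(** If the information exceeds [c] at some [b] beyond [theta0], monotonicity confines the shell
    below level [J b] to the left of [b]. Otherwise no point beyond [theta0] even reaches [c]:
    [Theta] being open, a slightly larger point would exceed it. The shell on this side is then at
    most [theta0]. *)
Lemma info_shell_right (c : R) : exists b c' : R, [/\ Theta b, c < c' &
  forall x, Theta x -> theta0 <= x -> c <= J x < c' -> x <= b].
Proof.
have [[b [Tb b0 cb]]|nb] := pselect (exists b, [/\ Theta b, theta0 < b & c < J b]).
  exists b, (J b); split => // x Tx x0 /andP[_ xb].
  rewrite leNgt; apply/negP => bx.
  have := info_ltr Theta_itv psi_derivable psi''_gt0 Tb Tx b0 bx.
  by rewrite ltNge (ltW xb).
exists theta0, (c + 1); split => //; first by rewrite ltrDl.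
move=> x Tx x0 /andP[cx _]; rewrite leNgt; apply/negP => x0'.
have [r r0 Hr] := open_interval_widen Theta_open Tx.
have Ty : Theta (x + r / 2).
  by apply: Hr; rewrite addrAC subrr add0r gtr0_norm ?divr_gt0//; lra.
have xy : x < x + r / 2 by rewrite ltrDl divr_gt0.
apply: nb; exists (x + r / 2); split => //; first exact: lt_trans xy.
apply: le_lt_trans cx _.
by have := info_ltr Theta_itv psi_derivable psi''_gt0 Tx Ty x0' xy.
Qed.

Lemma info_shell_left (c : R) : exists a c' : R, [/\ Theta a, c < c' &
  forall x, Theta x -> x <= theta0 -> c <= J x < c' -> a <= x].
Proof.
have [[b [Tb b0 cb]]|nb] := pselect (exists b, [/\ Theta b, b < theta0 & c < J b]).
  exists b, (J b); split => // x Tx x0 /andP[_ xb].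
  rewrite leNgt; apply/negP => bx.
  have := info_ltl Theta_itv psi_derivable psi''_gt0 Tb Tx b0 bx.
  by rewrite ltNge (ltW xb).
exists theta0, (c + 1); split => //; first by rewrite ltrDl.
move=> x Tx x0 /andP[cx _]; rewrite leNgt; apply/negP => x0'.
have [r r0 Hr] := open_interval_widen Theta_open Tx.
have Ty : Theta (x - r / 2).
  by apply: Hr; rewrite addrAC subrr add0r normrN gtr0_norm ?divr_gt0//; lra.
have xy : x - r / 2 < x by rewrite ltrBlDr ltrDl divr_gt0.
apply: nb; exists (x - r / 2); split => //; first exact: lt_trans xy _.
apply: le_lt_trans cx _.
by have := info_ltl Theta_itv psi_derivable psi''_gt0 Tx Ty x0' xy.
Qed.

(** The width [c' - c] cannot be prescribed: if [info] is bounded on one side and [c'] lies above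
    its values there, the shell may run to the boundary of [Theta]. *)
Lemma info_shell (c : R) : exists a b c' : R,
  [/\ forall x, a <= x <= b -> Theta x, c < c' &
      forall x, Theta x -> c <= J x < c' -> a <= x <= b].
Proof.
have [b [cb [Tb ccb Hb]]] := info_shell_right c.
have [a [ca [Ta cca Ha]]] := info_shell_left c.
exists (Num.min a theta0), (Num.max b theta0), (Num.min ca cb); split.
- move=> x; apply: Theta_itv; first by rewrite /Num.min; case: ifP.
  by rewrite /Num.max; case: ifP.
- by rewrite lt_min cca.
move=> x Tx; rewrite lt_min => /and3P[cx xa xb].
have [x0|x0] := leP x theta0.
  by rewrite ge_min Ha ?cx//= le_max x0 orbT.
by rewrite le_max Hb ?cx ?(ltW x0)//= andbT ge_min (ltW x0) orbT.
Qed.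

End information_shell.

(** * Entropy bounds and tameness of the minimizers *)

Section finite_entropy_tame.
Context (R : realType) (psi : R -> R) (Theta : set R) (theta0 : R).
Context (G : probability (measurableTypeR R) R).
Hypothesis Theta_open : open Theta.
Hypothesis Theta_itv : is_interval Theta.
Hypothesis Theta0 : Theta theta0.
Hypothesis psi_derivable : forall theta, Theta theta ->
  derivable psi theta 1 /\ derivable (derive1 psi) theta 1.
Hypothesis psi''_gt0 : forall theta, Theta theta -> 0 < derive1 (derive1 psi) theta.
Hypothesis G_Theta : G Theta = 1%E.
Context (I : Type) (Gamma : set I) (h : I -> R -> R).
Context (H : I -> probability (measurableTypeR R) R).
Hypothesis mixH : mixing_family Theta Gamma h H.
Local Notation J := (info psi ^~ theta0).

Let mT : measurable (Theta : set (measurableTypeR R)).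
Proof. exact: open_measurable. Qed.

(* weight and criterion depend on (M, alpha) only through c = log(1/alpha)/M. *)
Definition cut_weight (c x : R) : R :=
  \1_[set y | Theta y /\ c <= J y] x * (J x)^-1.

Definition cut_criterion (c : R) (g : I) : \bar R :=
  (- \int[G]_(x in Theta) (cut_weight c x * ln (h g x))%:E)%E.

Let mJ : measurable_fun (Theta : set (measurableTypeR R)) J.
Proof.
by apply: measurable_continuous_on => // x Tx; exact: (info_continuous psi_derivable).
Qed.

Lemma cut_weightE c x : Theta x -> c <= J x -> cut_weight c x = (J x)^-1.
Proof. by move=> Tx cx; rewrite /cut_weight indicE mem_set// mul1r. Qed.

Lemma cut_weight0 c x : J x < c -> cut_weight c x = 0.
Proof.
move=> cx; rewrite /cut_weight indicE memNset ?mul0r// => -[_].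
by rewrite leNgt cx.
Qed.

Lemma cut_weight_ge0 c x : 0 < c -> Theta x -> 0 <= cut_weight c x.
Proof.
move=> c0 Tx; have [cx|xc] := leP c (J x); last by rewrite cut_weight0.
by rewrite cut_weightE// invr_ge0 (le_trans (ltW c0)).
Qed.

Lemma cut_weight_le c0 c x : 0 < c0 -> c0 <= c -> Theta x -> cut_weight c x <= c0^-1.
Proof.
move=> c00 cc Tx; have [cx|xc] := leP c (J x); last first.
  by rewrite cut_weight0// invr_ge0 ltW.
rewrite cut_weightE// lef_pV2 ?posrE//; first exact: le_trans cx.
by apply: lt_le_trans (le_trans cc cx).
Qed.

Lemma measurable_cut_weight c : 0 < c ->
  measurable_fun (Theta : set (measurableTypeR R)) (cut_weight c).
Proof.
move=> c0.
have mA : measurable ([set y | Theta y /\ c <= J y] : set (measurableTypeR R)).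
  have -> : [set y | Theta y /\ c <= J y] = Theta `&` [set y | c <= J y].
    by apply/seteqP; split.
  exact: measurable_fun_le.
(* On the support of the indicator the maximum is the information itself; elsewhere it keeps the
   inverse continuous. *)
have EE x : cut_weight c x = \1_[set y | Theta y /\ c <= J y] x * (Num.max c (J x))^-1.
  have [cx|xc] := leP c (J x); first by [].
  by rewrite cut_weight0// indicE memNset ?mul0r// => -[_]; rewrite leNgt xc.
rewrite (_ : cut_weight c = fun x => \1_[set y | Theta y /\ c <= J y] x *
  (Num.max c (J x))^-1); last by apply/funext => x; exact: EE.
apply: measurable_funM; first exact/measurable_funTS/measurable_indic.
apply: measurable_continuous_on => // x Tx.
have cJ := @info_continuous _ _ _ theta0 psi_derivable x Tx.
apply: cvgV; first by rewrite gt_eqF// lt_max c0.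
under eq_fun do rewrite maxr_absE; rewrite maxr_absE.
apply: cvgM; last exact: cvg_cst.
apply: cvgD; first by apply: cvgD => //; exact: cvg_cst.
by apply: cvg_norm; apply: cvgB => //; exact: cvg_cst.
Qed.

Lemma measurable_ln_density g : Gamma g ->
  measurable_fun (Theta : set (measurableTypeR R)) (fun x => ln (h g x)).
Proof.
move=> /mixH[_ hc _]; apply: measurableT_comp => //.
exact: measurable_continuous_on.
Qed.

Lemma measurable_cut_integrand c g : 0 < c -> Gamma g ->
  measurable_fun (Theta : set (measurableTypeR R))
    (fun x => cut_weight c x * ln (h g x)).
Proof.
by move=> c0 Gg; apply: measurable_funM;
  [exact: measurable_cut_weight|exact: measurable_ln_density].
Qed.

Lemma cut_criterion_fin c g : 0 < c -> Gamma g -> cut_criterion c g \is a fin_num ->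
  (\int[G]_(x in Theta) `|(cut_weight c x * ln (h g x))%:E| < +oo)%E.
Proof.
move=> c0 Gg; rewrite fin_numN integral_fin_num_abs//.
exact: measurable_cut_integrand.
Qed.

(* One minimizer at a cut close to the infimum of all cuts that admit one
   bounds the minimal criterion at every larger cut: the sets A shrink as the
   cut grows, and the shell left uncovered is relatively compact in Theta. *)
Lemma min_criterion_bounded (c0 : R) : 0 < c0 ->
  exists2 K : R, 0 <= K & forall c g, c0 <= c ->
    is_argmin Gamma (cut_criterion c) g -> (cut_criterion c g <= K%:E)%E.
Proof.
move=> c00.
pose E := [set c | c0 <= c /\ exists g, is_argmin Gamma (cut_criterion c) g].
have [E0|/set0P nE] := eqVneq E set0.
  exists 0 => // c g cc ag; have : E c by split => //; exists g.
  by rewrite E0.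
have Einf : has_inf E by split => //; exists c0 => c [].
have c0i : c0 <= inf E by apply: lb_le_inf => // c [].
have [a [b [c' [abT cc' shell]]]] := info_shell Theta_open Theta_itv Theta0
  psi_derivable psi''_gt0 (inf E).
have cc'0 : 0 < c' - inf E by rewrite subr_gt0.
have [c1 [c01 [g1 [Gg1 fin1 min1]]]] := inf_adherent cc'0 Einf.
rewrite addrC subrK => c1c'.
have c10 : 0 < c1 by apply: lt_le_trans c01.
have [h_gt0 h_cont _] := mixH Gg1.
have lncont x : Theta x -> {for x, continuous (fun x => ln (h g1 x))}.
  move=> Tx; apply: (@continuous_comp _ _ _ (h g1)); first exact: h_cont.
  by apply: continuous_ln; exact: h_gt0.
have [B B0 HB] := continuous_bounded_on abT lncont.
have I1 := cut_criterion_fin c10 Gg1 fin1.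
have mI1 := measurable_cut_integrand c10 Gg1.
have Ifin : (\int[G]_(x in Theta) `|(cut_weight c1 x * ln (h g1 x))%:E|)%E \is a fin_num.
  by rewrite ge0_fin_numE//; exact: integral_ge0.
have I0 : (0 <= \int[G]_(x in Theta) `|(cut_weight c1 x * ln (h g1 x))%:E|)%E.
  exact: integral_ge0.
(* The integral pays for the points above the cut [c1]; [c0^-1 * B] pays for the shell, where the
   weight is at most [c0^-1] and [ln (h g1 x)] is bounded by [B]. *)
exists (fine (\int[G]_(x in Theta) `|(cut_weight c1 x * ln (h g1 x))%:E|)%E + c0^-1 * B).
  by rewrite addr_ge0 ?fine_ge0// mulr_ge0// ?invr_ge0 ltW.
move=> c g cc ag; have [Gg fg ming] := ag.
have c_gt0 : 0 < c by apply: lt_le_trans cc.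
apply: (le_trans (ming _ Gg1)).
have Ec : inf E <= c.
  have Ec : E c by split => //; exists g.
  by have := ge_inf Einf.2 Ec.
apply: (@le_trans _ _ `|\int[G]_(x in Theta) (cut_weight c x * ln (h g1 x))%:E|%E).
  by rewrite /cut_criterion -abseN; exact: lee_abs.
have mIc := measurable_cut_integrand c_gt0 Gg1.
apply: (le_trans (le_abse_integral G mT _)); first exact/measurable_EFinP.
rewrite EFinD fineK//.
have -> : ((c0^-1 * B)%:E = \int[G]_(x in Theta) (cst (c0^-1 * B)%:E x))%E.
  by rewrite integral_cst// [X in (_ * X)%E]G_Theta mule1.
have mI1a : measurable_fun (Theta : set (measurableTypeR R))
    (fun x => `|(cut_weight c1 x * ln (h g1 x))%:E|%E).
  by apply: measurableT_comp => //; exact/measurable_EFinP.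
have cB0 : 0 <= c0^-1 * B by rewrite mulr_ge0// ?invr_ge0 ltW.
rewrite -ge0_integralD//.
apply: ge0_le_integral_nomeas => x Tx //=.
rewrite lee_fin normrM.
have [cx|xc] := leP c (J x); last first.
  by rewrite (cut_weight0 xc) normr0 mul0r addr_ge0.
(* Above both cuts the two weights coincide. Otherwise [inf E <= c <= J x < c1 < c'], and [x] is in
   the shell. *)
have [c1x|xc1] := leP c1 (J x).
  by rewrite (cut_weightE Tx cx) normrM (cut_weightE Tx c1x) lerDl.
apply: ler_wpDl => //; apply: ler_pM => //.
  by rewrite ger0_norm ?cut_weight_ge0// cut_weight_le.
apply: HB; apply: shell => //.
by rewrite (le_trans Ec cx)/= (lt_trans xc1).
Qed.

(** Where [f > 0], log^+ h <= log^+ f + h / f, by ln y <= y - 1 at y = h / f. Integrating against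
    [f] leaves the entropy term plus the mass of [h], at most 1; only this mass depends on [g]. *)
Lemma pos_log_density_bounded : finite_entropy G ->
  exists2 K : R, 0 <= K & forall g, Gamma g ->
    (\int[G]_(x in Theta) (Num.max 0 (ln (h g x)))%:E <= K%:E)%E.
Proof.
move=> [f [mf f0 fdens entf]].
set Ent := (\int[G]_x (Num.max 0 (ln (f x)))%:E)%E in entf.
have pos0 (y : R) : 0 <= Num.max 0 y by rewrite le_max lexx.
have Ent0 : (0 <= Ent)%E by apply: integral_ge0 => x _; rewrite lee_fin.
have Entfin : Ent \is a fin_num by rewrite ge0_fin_numE.
have mpos (D : set (measurableTypeR R)) (u : R -> R) : measurable_fun D u ->
    measurable_fun D (fun x => Num.max 0 (u x)).
  by move=> mu; apply: (measurable_maxr (f := cst 0)).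
have mlnf : measurable_fun [set: measurableTypeR R] (fun x => Num.max 0 (ln (f x))).
  by apply: mpos; apply: measurableT_comp.
exists (1 + fine Ent); first by rewrite addr_ge0// fine_ge0.
move=> g Gg; have [h_gt0 h_cont Hh] := mixH Gg.
pose phi := (fun x => Num.max 0 (ln (h g x))) \_ Theta.
have mphi : measurable_fun [set: measurableTypeR R] phi.
  apply/(measurable_restrictT _ _).1 => //; apply: mpos.
  exact: measurable_ln_density.
have phi0 x : 0 <= phi x by rewrite /phi /patch; case: ifP.
have dens (u : R -> R) : measurable_fun [set: measurableTypeR R] u -> (forall x, 0 <= u x) ->
    (\int[G]_x (u x)%:E = \int[lebesgue_measure]_x ((u x)%:E * (f x)%:E))%E.
  move=> mu u0.
  apply: (@ge0_integral_density_comp _ (measurableTypeR R) R _ (measurableTypeR R)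
    lebesgue_measure id f G (fun x => (u x)%:E)) => //.
    exact/measurable_EFinP.
have -> : (\int[G]_(x in Theta) (Num.max 0 (ln (h g x)))%:E = \int[G]_x (phi x)%:E)%E.
  rewrite integral_mkcond; apply: eq_integral => x _.
  by rewrite /phi /patch; case: ifP.
rewrite (dens _ mphi phi0).
pose hT := (h g) \_ Theta.
have hT0 x : 0 <= hT x.
  by rewrite /hT /patch; case: ifPn => // /set_mem /h_gt0 /ltW.
have mhT : measurable_fun [set: measurableTypeR R] hT.
  apply/(measurable_restrictT _ _).1 => //.
  exact: measurable_continuous_on.
apply: (@le_trans _ _ (\int[lebesgue_measure]_x ((hT x)%:E +
    (Num.max 0 (ln (f x)))%:E * (f x)%:E))%E).
  apply: ge0_le_integral_nomeas => x _.
    by rewrite mule_ge0 ?lee_fin.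
  rewrite -!EFinM -EFinD lee_fin /phi /hT /patch; case: ifPn => [/set_mem Tx|_]; last first.
    by rewrite mul0r addr_ge0// mulr_ge0.
  have hx := h_gt0 _ Tx.
  (* Where [f] vanishes, so does the left-hand side. *)
  have := f0 x; rewrite le_eqVlt => /predU1P[<-|fx].
    by rewrite !mulr0 addr0 ltW.
  have hq : 0 < h g x / f x by rewrite divr_gt0.
  have lnle : ln (h g x) <= ln (f x) + (h g x / f x - 1).
    rewrite -lerBlDl -ln_div ?posrE//.
    have := @le_ln1Dx R (h g x / f x - 1); rewrite [1 + _]addrC subrK; apply; lra.
  have lf : ln (f x) <= Num.max 0 (ln (f x)) by rewrite le_max lexx orbT.
  have h1 : Num.max 0 (ln (h g x)) <= Num.max 0 (ln (f x)) + h g x / f x.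
    rewrite ge_max addr_ge0 ?pos0 ?(ltW hq)//=; lra.
  by have := ler_wpM2r (ltW fx) h1; rewrite mulrDl divfK ?gt_eqF//; lra.
rewrite ge0_integralD//; last 4 first.
- by move=> x _; rewrite lee_fin.
- exact/measurable_EFinP.
- by move=> x _; rewrite mule_ge0 ?lee_fin.
- by apply: emeasurable_funM; exact/measurable_EFinP.
rewrite -(dens (fun x => Num.max 0 (ln (f x))))// -/Ent EFinD fineK// leeD2r//.
have -> : (\int[lebesgue_measure]_x (hT x)%:E = H g Theta)%E.
  rewrite Hh// setIid [RHS]integral_mkcond; apply: eq_integral => x _.
  by rewrite /hT /patch; case: ifP.
exact: probability_le1.
Qed.


(** Bounding the criterion by [K1] and its positive logarithmic part by [C * K2] bounds the weighted
    negative part by [K3]. On the exceptional set the weight is at least [B^-1] and the negative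
    part of [ln h] at least [e * L], so its [G]-mass is at most [K3 * B / (e * L)]. *)
Lemma finite_entropy_tame (K : set I) (M : R -> nat) (C : R) : K `<=` Gamma ->
  (forall alpha, (0 < M alpha)%N) -> 0 < C ->
  (\forall alpha \near 0^'+, (M alpha)%:R <= C * ln alpha^-1) ->
  finite_entropy G ->
  tame psi Theta theta0 G h M (fun alpha gs => K gs /\
    is_argmin Gamma (criterion psi Theta theta0 G h (M alpha) alpha) gs).
Proof.
move=> KG M0 C0 MC entG a b e dl abT e0 dl0.
have c00 : 0 < C^-1 by rewrite invr_gt0.
have [K1 K10 HK1] := min_criterion_bounded c00.
have [K2 K20 HK2] := pos_log_density_bounded entG.
have [B B0 HB] := continuous_bounded_on abT
  (@info_continuous _ _ _ theta0 psi_derivable).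
pose K3 := K1 + C * K2.
have K30 : 0 <= K3 by rewrite addr_ge0// mulr_ge0// ltW.
near=> alpha => gs [Kgs ag].
have Gg := KG _ Kgs; have [h_gt0 h_cont _] := mixH Gg.
have MCa : (M alpha)%:R <= C * ln alpha^-1 by near: alpha.
have [a0 L1] : 0 < alpha /\ 1 <= ln alpha^-1 by near: alpha; exact: near_ln_inv.
have [_ LK] : 0 < alpha /\ K3 * B / (e * dl) <= ln alpha^-1.
  by near: alpha; exact: near_ln_inv.
have Mr0 : 0 < (M alpha)%:R :> R by rewrite ltr0n.
set L := ln alpha^-1 in MCa L1 LK *.
have L0 : 0 < L by apply: lt_le_trans L1.
pose c := L / (M alpha)%:R.
have c_gt0 : 0 < c by rewrite divr_gt0.
(* The growth condition on [M] enters here: the cut stays away from 0, so the weights are at most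
   [C]. *)
have cc : C^-1 <= c by rewrite ler_pdivlMr// mulrC ler_pdivrMr// mulrC.
(* [criterion] at [(M alpha, alpha)] unfolds to [cut_criterion] at [c]. *)
have crit_le := HK1 c gs cc ag.
have [_ crit_fin _] := ag.
pose w := cut_weight c; pose l x := ln (h gs x).
have w0 x : Theta x -> 0 <= w x by exact: cut_weight_ge0.
have mw : measurable_fun (Theta : set (measurableTypeR R)) w by exact: measurable_cut_weight.
have ml : measurable_fun (Theta : set (measurableTypeR R)) l by exact: measurable_ln_density.
set Pp := (\int[G]_(x in Theta) (w x * Num.max 0 (l x))%:E)%E.
set Nn := (\int[G]_(x in Theta) (w x * Num.max 0 (- l x))%:E)%E.
have intE : (\int[G]_(x in Theta) (w x * l x)%:E = Pp - Nn)%E.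
  rewrite integralE; congr (_ - _)%E; apply: eq_integral => x /set_mem Tx.
    by rewrite funeposE -EFin_max maxr_pMr ?w0// mulr0 maxC.
  by rewrite funenegE -EFinN -EFin_max maxr_pMr ?w0// mulr0 mulrN maxC.
have PK : (Pp <= (C * K2)%:E)%E.
  apply: (@le_trans _ _ (\int[G]_(x in Theta) (C%:E * (Num.max 0 (l x))%:E))%E).
    apply: ge0_le_integral_nomeas => x Tx.
      by rewrite lee_fin mulr_ge0 ?w0// le_max lexx.
    rewrite -EFinM lee_fin ler_wpM2r// ?le_max ?lexx//.
    by rewrite -[leRHS]invrK cut_weight_le.
  rewrite ge0_integralZl//.
  - by rewrite EFinM lee_wpmul2l ?lee_fin ?(ltW C0)//; exact: HK2.
  - apply/measurable_EFinP.
    by apply: (measurable_maxr (f := cst 0)).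
  - by move=> x _; rewrite lee_fin le_max lexx.
  - by rewrite lee_fin ltW.
(* Finiteness of the minimal value makes both parts finite, so the inequality can be rearranged in
   [R]. *)
have PN_fin : (Pp - Nn)%E \is a fin_num.
  by move: crit_fin; rewrite fin_numN -intE.
have [Pfin Nfin] : Pp \is a fin_num /\ Nn \is a fin_num.
  by move: PN_fin; rewrite fin_numB => /andP[].
have NK : fine Nn <= K3.
  have : (- (Pp - Nn) <= K1%:E)%E by rewrite -intE.
  move: PK; rewrite -(fineK Pfin) -(fineK Nfin) -EFinB -EFinN !lee_fin.
  by rewrite /K3; lra.
pose D := [set x : R | [/\ a <= x <= b, c <= J x & h gs x < expR (- (e * L))]].
have DT : D `<=` Theta by move=> x [/abT].
have mD : measurable (D : set (measurableTypeR R)).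
  pose A := [set x : R | a <= x <= b].
  have mA : measurable (A : set (measurableTypeR R)).
    have -> : A = [set` `[a, b]] by apply/seteqP; split => x /=; rewrite in_itv.
    exact: measurable_itv.
  have AT : A `<=` Theta by move=> x /abT.
  have -> : D = (A `&` [set x | c <= J x]) `\` (A `&` [set x | expR (- (e * L)) <= h gs x]).
    apply/seteqP; split => x; rewrite /D /=.
      by move=> [xab cx hx]; split => // -[_]; rewrite leNgt hx.
    move=> [[xab cx] hx]; split => //; rewrite ltNge; apply/negP => hx'.
    exact: hx.
  apply: measurableD.
    by apply: measurable_fun_le => //; exact: measurable_funS mT AT mJ.
  apply: measurable_fun_le => //; apply: measurable_funS mT AT _.
  exact: measurable_continuous_on.
have GD : ((e * L / B)%:E * G D <= Nn)%E.
  have -> : ((e * L / B)%:E * G D = \int[G]_(x in Theta) (e * L / B * \1_D x)%:E)%E.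
    under eq_integral do rewrite EFinM.
    rewrite ge0_integralZl//.
    - by rewrite integral_indic// setIidl.
    - by apply/measurable_EFinP/measurable_funTS; exact: measurable_indic.
    - by rewrite lee_fin divr_ge0// ?mulr_ge0 ?(ltW e0) ?(ltW L0) ?(ltW B0).
  have eLB : 0 <= e * L / B by apply: divr_ge0 (ltW B0); apply: mulr_ge0 (ltW L0); exact: ltW.
  apply: ge0_le_integral_nomeas => x Tx.
    by rewrite lee_fin mulr_ge0.
  rewrite lee_fin indicE; have [/set_mem Dx|_] := boolP (x \in D); last first.
    by rewrite mulr0 mulr_ge0 ?w0// le_max lexx.
  have [xab cx hx] := Dx; rewrite mulr1 /w cut_weightE// mulrC.
  have Jx0 : 0 < J x by apply: lt_le_trans cx.
  apply: ler_pM => //.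
  - by rewrite invr_ge0 ltW.
  - by rewrite mulr_ge0// ltW.
  - by rewrite lef_pV2 ?posrE// (le_trans (ler_norm _))// HB.
  - rewrite le_max lerNr; apply/orP; right.
    by rewrite -[leRHS]expRK ler_ln ?posrE ?expR_gt0 ?h_gt0// ltW.
have GDfin : G D \is a fin_num by rewrite fin_num_measure.
rewrite -(fineK GDfin) lee_fin.
move: GD; rewrite -(fineK GDfin) -(fineK Nfin) -EFinM lee_fin => GD.
have h1 : e * L / B * fine (G D) <= K3 by apply: le_trans NK.
have eLB : 0 < e * L / B by rewrite divr_gt0// mulr_gt0.
rewrite -(ler_pM2l eLB) (le_trans h1)//.
move: LK; rewrite ler_pdivrMr ?mulr_gt0// => LK.
rewrite (_ : e * L / B * dl = (L * (e * dl)) / B); last by ring.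
by rewrite ler_pdivlMr.
Unshelve. all: end_near. Qed.

End finite_entropy_tame.

(** * Conjugate families *)

Section laplace_transform.
Context (R : realType) (m : {measure set (measurableTypeR R) -> \bar R}).
Context (D : set (measurableTypeR R)) (Y v : R -> R).
Hypothesis mD : measurable D.
Hypothesis mY : measurable_fun D Y.
Hypothesis mv : measurable_fun D v.
Hypothesis v_ge0 : forall x, 0 <= v x.

Let f (t x : R) : R := expR (t * Y x) * v x.

Let f_ge0 t x : 0 <= f t x.
Proof. by rewrite mulr_ge0 ?expR_ge0. Qed.

Let mf t : measurable_fun D (f t).
Proof.
apply: measurable_funM => //; apply: measurableT_comp => //.
exact: measurable_funM.
Qed.

Let f_derive (t x : R) : is_derive t 1 (f ^~ x) (Y x * f t x).
Proof.
have h1 : is_derive t 1 (fun u : R => u * Y x) (Y x).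
  apply: (is_derive_eq (is_deriveM (is_derive_id t 1) (is_derive_cst (Y x) t 1))).
  by rewrite scaler0 add0r; exact: mulr1.
have h2 := @is_derive1_comp _ expR (fun u => u * Y x) t _ _
  (is_derive_expR (t * Y x)) h1.
apply: (is_derive_eq (is_deriveM h2 (is_derive_cst (v x) t 1))).
rewrite scaler0 add0r /f -[_ *: _]/(v x * (expR (t * Y x) * Y x)); ring.
Qed.

(* |Y| e^{tY} is dominated near t0 by e^{(t0 + 2s) Y} + e^{(t0 - 2s) Y}. *)
Lemma laplace_derivable (t0 r : R) : 0 < r ->
  (forall t, `|t - t0| < r -> (\int[m]_(x in D) (f t x)%:E < +oo)%E) ->
  derivable (fun t => \int[m]_(x in D) f t x)%R t0 1.
Proof.
move=> r0 finf; pose s := r / 4; have s0 : 0 < s by rewrite divr_gt0.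
have int_f t : `|t - t0| < r -> m.-integrable D (EFin \o f t).
  move=> tr; apply/integrableP; split; first exact/measurable_EFinP.
  by under eq_integral do rewrite /= ger0_norm//; exact: finf.
pose Gd x := s^-1 * (f (t0 + 2 * s) x + f (t0 - 2 * s) x).
apply: (@derivable_under_integral R _ (measurableTypeR R) m f D mD t0 (t0 - s) (t0 + s)
  _ _ _ Gd).
- by rewrite /= in_itv/=; apply/andP; split; lra.
- move=> t; rewrite /= in_itv/= => /andP[t1 t2]; apply: int_f.
  by rewrite ltr_norml; apply/andP; split; rewrite /s in t1 t2; lra.
- by move=> t x _ _; have [] := f_derive t x.
- by move=> x; rewrite mulr_ge0 ?invr_ge0 ?(ltW s0)// addr_ge0.
- have I1 : `|t0 + 2 * s - t0| < r.
    by rewrite addrAC subrr add0r gtr0_norm ?mulr_gt0// /s; lra.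
  have I2 : `|t0 - 2 * s - t0| < r.
    by rewrite addrAC subrr add0r normrN gtr0_norm ?mulr_gt0// /s; lra.
  have := integrableZl mD s^-1 (integrableD mD (int_f _ I1) (int_f _ I2)).
  by apply: eq_integrable.
move=> t x; rewrite /= in_itv/= => /andP[t1 t2] _.
rewrite /partial1of2 derive1E; have [_ ->] := f_derive t x.
rewrite normrM (ger0_norm (f_ge0 _ _)) /Gd /f -mulrDl 2!mulrA ler_wpM2r//.
(* The linear factor is absorbed by one exponential [s], and moving [t] by less than [s] costs a
   second one; hence the shift by [2 * s], which is half of [r]. *)
have hs : `|Y x| <= s^-1 * expR (s * `|Y x|).
  rewrite mulrC ler_pdivlMr// mulrC.
  by have := expR_ge1Dx (s * `|Y x|); lra.
have ht : expR (t * Y x) <= expR (t0 * Y x + s * `|Y x|).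
  rewrite ler_expR -lerBlDl -mulrBl (le_trans (ler_norm _))// normrM ler_wpM2r//.
  by rewrite ler_norml; apply/andP; split; lra.
apply: (le_trans (ler_pM (normr_ge0 _) (expR_ge0 _) hs ht)).
rewrite -mulrA ler_pM2l ?invr_gt0// -expRD.
have [Y0|Y0] := leP 0 (Y x).
  rewrite ger0_norm//.
  rewrite (_ : s * Y x + (t0 * Y x + s * Y x) = (t0 + 2 * s) * Y x); last by ring.
  by rewrite lerDl expR_ge0.
rewrite ltr0_norm//.
rewrite (_ : s * - Y x + (t0 * Y x + s * - Y x) = (t0 - 2 * s) * Y x); last by ring.
by rewrite lerDr expR_ge0.
Qed.

(** Normalization makes [Q] the inverse of a nonvanishing Laplace transform. The general form with
    [Y] and [v] serves both coordinates of the conjugate family: [Y] is the identity for the first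
    and [- psi] for the second, the other factor going into [v]. *)
Lemma normalizer_derivable (Q : R -> R) (t0 r : R) : 0 < r ->
  (forall t, `|t - t0| < r ->
     0 < Q t /\ (\int[m]_(x in D) (Q t * f t x)%:E = 1)%E) ->
  forall t, `|t - t0| < r -> derivable Q t 1.
Proof.
move=> r0 HQ t tr; pose F t := (\int[m]_(x in D) f t x)%R.
have FE u : `|u - t0| < r -> (\int[m]_(x in D) (f u x)%:E = ((Q u)^-1)%:E)%E.
  move=> /HQ[Q0 HQu].
  transitivity (\int[m]_(x in D) (((Q u)^-1)%:E * (Q u * f u x)%:E))%E.
    by apply: eq_integral => x _; rewrite -EFinM mulKf ?gt_eqF.
  rewrite ge0_integralZl//.
  - by rewrite HQu mule1.
  - by apply/measurable_EFinP; exact: measurable_funM.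
  - by move=> x _; rewrite lee_fin mulr_ge0// ltW.
  - by rewrite lee_fin invr_ge0 ltW.
have FQ u : `|u - t0| < r -> F u = (Q u)^-1.
  by move=> ur; rewrite /F /Rintegral FE.
have d0 : 0 < r - `|t - t0| by rewrite subr_gt0.
have near_t u : `|u - t| < r - `|t - t0| -> `|u - t0| < r.
  move=> ut; rewrite (_ : u - t0 = (u - t) + (t - t0)); last by ring.
  by rewrite (le_lt_trans (ler_normD _ _))// -ltrBrDr.
have dF : derivable F t 1.
  apply: (laplace_derivable d0) => u /near_t ur.
  by rewrite FE// ltry.
have Ft : F t != 0 by rewrite FQ// invr_eq0 gt_eqF//; case: (HQ t tr).
apply: (near_eq_derivable _ (derivableV Ft dF)).
apply/nbhs_ballP; exists (r - `|t - t0|) => //= u; rewrite /ball/= distrC => /near_t ur.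
by rewrite FQ// invrK.
Qed.

End laplace_transform.

(** Fermat's rule for [W * ln Q + a * t], multiplied out by [Q t0]. The product form avoids dividing
    by [W] or by the derivative of [Q], not yet known to be nonzero. *)
Lemma log_stationary (R : realType) (Q : R -> R) (t0 r W a : R) : 0 < r ->
  (forall t, `|t - t0| < r -> 0 < Q t /\ derivable Q t 1) ->
  (forall t, `|t - t0| < r -> W * ln (Q t) + a * t <= W * ln (Q t0) + a * t0) ->
  W * derive1 Q t0 = - a * Q t0.
Proof.
move=> r0 HQ Hmax; pose f t := W * ln (Q t) + a * t.
have fd t : `|t - t0| < r -> is_derive t 1 f (W * ((Q t)^-1 * derive1 Q t) + a).
  move=> /HQ[Q0 dQ].
  have h1 : is_derive t 1 (fun t => ln (Q t)) ((Q t)^-1 * derive1 Q t).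
    exact: is_derive1_comp (is_derive1_ln Q0) (DeriveDef dQ (esym (derive1E _ _))).
  have h2 := is_deriveM (is_derive_cst W t 1) h1.
  have h3 := is_deriveM (is_derive_cst a t 1) (is_derive_id t 1).
  apply: (is_derive_eq (is_deriveD h2 h3)).
  rewrite !scaler0 !addr0 -[W *: _]/(W * _) -[a *: _]/(a * _) mulr1//.
have itvr t : t \in `]t0 - r, t0 + r[%R -> `|t - t0| < r.
  by rewrite in_itv/= => /andP[t1 t2]; rewrite ltr_norml; apply/andP; split; lra.
have t0r : `|t0 - t0| < r by rewrite subrr normr0.
have := @derive1_at_max R f (t0 - r) (t0 + r) t0.
have [Q0 _] := HQ t0 t0r.
move=> /(_ _ _ _ _)[].
- lra.
- by move=> t /itvr /fd[].
- by rewrite in_itv/=; apply/andP; split; lra.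
- by move=> t /itvr /Hmax.
move=> _ f0; have [_ f1] := fd t0 t0r; rewrite f0 in f1.
have Qn : Q t0 != 0 by rewrite gt_eqF.
have : (W * ((Q t0)^-1 * derive1 Q t0) + a) * Q t0 = 0 by rewrite -f1 mul0r.
rewrite mulrDl (_ : W * _ * Q t0 = W * derive1 Q t0 * (Q t0 * (Q t0)^-1)); last by ring.
by rewrite divff// mulr1; lra.
Qed.

(** * First-order conditions for conjugate mixing densities *)

Section conjugate_family.
Context (R : realType) (psi : R -> R) (Theta : set R) (theta0 : R).
Context (G : probability (measurableTypeR R) R).
Hypothesis Theta_open : open Theta.
Hypothesis Theta0 : Theta theta0.
Hypothesis psi_derivable : forall theta, Theta theta ->
  derivable psi theta 1 /\ derivable (derive1 psi) theta 1.
Context (Gamma : set (R * R)) (q : R -> R -> R).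
Context (H : R * R -> probability (measurableTypeR R) R) (M : nat) (alpha : R).
Context (gs : R * R).
Hypothesis mixH : mixing_family Theta Gamma (conjugate_density psi q) H.
Hypothesis M0 : (0 < M)%N.
Hypothesis alpha01 : 0 < alpha < 1.
Hypothesis argmin_gs : is_argmin Gamma
  (criterion psi Theta theta0 G (conjugate_density psi q) M alpha) gs.
Hypothesis gs_int : interior Gamma gs.

Local Notation wt := (weight psi Theta theta0 M alpha).
Hypothesis int_theta : G.-integrable Theta (fun theta => (wt theta * theta)%:E).
Hypothesis int_psi : G.-integrable Theta (fun theta => (wt theta * psi theta)%:E).

Let mT : measurable (Theta : set (measurableTypeR R)).
Proof. exact: open_measurable. Qed.

Let Rint (u : R -> R) : R := Rintegral G Theta u.
Let W := Rint wt.
Let a := Rint (fun theta => wt theta * theta).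
Let b := Rint (fun theta => wt theta * psi theta).

Lemma normalizer_gt0 g : Gamma g -> 0 < q g.1 g.2.
Proof.
move=> /mixH[h0 _ _]; have := h0 _ Theta0.
by rewrite /conjugate_density pmulr_lgt0 ?expR_gt0.
Qed.

Let c0 : 0 < ln alpha^-1 / M%:R.
Proof.
have /andP[a0 a1] := alpha01.
by rewrite divr_gt0 ?ltr0n// ln_gt0// invf_gt1.
Qed.

Let mwt : measurable_fun (Theta : set (measurableTypeR R)) wt.
Proof. exact: (measurable_cut_weight theta0 Theta_open psi_derivable c0). Qed.

Let int_wt : G.-integrable Theta (EFin \o wt).
Proof.
apply: (@le_integrable _ _ _ G Theta mT _ (cst (ln alpha^-1 / M%:R)^-1%:E)).
- exact/measurable_EFinP.
- move=> x Tx /=; rewrite lee_fin !ger0_norm ?invr_ge0 ?(ltW c0)//.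
    by have := @cut_weight_le R psi Theta theta0 _ _ x c0 (lexx _) Tx.
  by have := @cut_weight_ge0 R psi Theta theta0 _ x c0 Tx.
- exact: finite_measure_integrable_cst.
Qed.

Lemma criterion_conjugate g : Gamma g ->
  criterion psi Theta theta0 G (conjugate_density psi q) M alpha g =
  (- (W * ln (q g.1 g.2) + g.1 * a - g.2 * b))%:E.
Proof.
move=> Gg; rewrite EFinN /criterion; congr (- _)%E.
have I1 := integrableZr mT (ln (q g.1 g.2)) int_wt.
have I2 := integrableZr mT g.1 int_theta.
have I3 := integrableZr mT g.2 int_psi.
have q0 := normalizer_gt0 Gg.
transitivity (\int[G]_(x in Theta) ((wt x * ln (q g.1 g.2))%:E +
    (wt x * x * g.1)%:E - (wt x * psi x * g.2)%:E))%E.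
  apply: eq_integral => x _; transitivity ((wt x * ln (q g.1 g.2) +
    wt x * x * g.1 - wt x * psi x * g.2)%:E); last by [].
  by rewrite /conjugate_density lnM ?posrE ?expR_gt0// expRK; congr (_)%:E; ring.
rewrite integralB//; last exact: integrableD.
rewrite integralD//.
have Z (u : R -> R) k : G.-integrable Theta (EFin \o u) ->
    (\int[G]_(x in Theta) (u x * k)%:E = (Rint u * k)%:E)%E.
  move=> iu; rewrite EFinM /Rint /Rintegral fineK ?integrable_fin_num//.
  by rewrite -integralZr.
rewrite (Z _ _ int_wt) (Z _ _ int_theta) (Z _ _ int_psi).
transitivity ((W * ln (q g.1 g.2) + a * g.1 - b * g.2)%:E); first by [].
by congr (_)%:E; ring.
Qed.

Lemma conjugate_objective_max g : Gamma g ->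
  W * ln (q g.1 g.2) + g.1 * a - g.2 * b <=
  W * ln (q gs.1 gs.2) + gs.1 * a - gs.2 * b.
Proof.
have [Ggs _ mins] := argmin_gs.
move=> Gg; have := mins _ Gg.
by rewrite !criterion_conjugate// lee_fin lerN2.
Qed.

Let ball_gs : exists2 r : R, 0 < r & forall t,
  (`|t - gs.1| < r -> Gamma (t, gs.2)) /\ (`|t - gs.2| < r -> Gamma (gs.1, t)).
Proof.
have /nbhs_ballP[r /= r0 Hr] : nbhs gs Gamma by exact: gs_int.
by exists r => // t; split => tr; apply: Hr; split => //=;
  rewrite ?ball_normE; rewrite /ball /= ?subrr ?normr0// distrC.
Qed.

Let total_mass g : Gamma g -> (\int[lebesgue_measure]_(x in Theta)
  (conjugate_density psi q g x)%:E = 1)%E.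
Proof.
move=> /mixH[_ _ Hg]; have := Hg _ measurableT.
by rewrite probability_setT setTI.
Qed.

Let mpsi : measurable_fun (Theta : set (measurableTypeR R)) psi.
Proof. by apply: measurable_continuous_on => //; exact: psi_continuous. Qed.

Lemma conjugate_stationary : b != 0 ->
  [/\ derivable (fun g1 : R => q g1 gs.2) gs.1 1,
      derivable (fun g2 : R => q gs.1 g2) gs.2 1,
      derive1 (fun g2 : R => q gs.1 g2) gs.2 != 0 &
      derive1 (fun g1 : R => q g1 gs.2) gs.1 /
      derive1 (fun g2 : R => q gs.1 g2) gs.2 = - (a / b)].
Proof.
move=> b0; have [r r0 Hr] := ball_gs.
have [Ggs _ _] := argmin_gs; have q0 := normalizer_gt0 Ggs.
have D1 t : `|t - gs.1| < r -> derivable (fun g1 : R => q g1 gs.2) t 1.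
  apply: (@normalizer_derivable R lebesgue_measure Theta id
    (fun x => expR (- (gs.2 * psi x))) mT) => //.
  - apply: measurableT_comp => //; apply: measurableT_comp => //.
    exact: measurable_funM.
  - move=> u /(Hr u).1 Gu; split; first exact: normalizer_gt0 Gu.
    rewrite -(total_mass Gu); apply: eq_integral => x _.
    by rewrite /conjugate_density /= -expRD.
have D2 t : `|t - gs.2| < r -> derivable (fun g2 : R => q gs.1 g2) t 1.
  apply: (@normalizer_derivable R lebesgue_measure Theta (fun x => - psi x)
    (fun x => expR (gs.1 * x)) mT) => //.
  - exact: measurableT_comp.
  - by apply: measurableT_comp => //; exact: measurable_funM.
  - move=> u /(Hr u).2 Gu; split; first exact: normalizer_gt0 Gu.
    rewrite -(total_mass Gu); apply: eq_integral => x _.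
    by rewrite /conjugate_density /= -expRD; congr (_ * expR _)%:E; ring.
have S1 : W * derive1 (fun g1 : R => q g1 gs.2) gs.1 = - a * q gs.1 gs.2.
  apply: (@log_stationary R (fun g1 : R => q g1 gs.2) gs.1 r W a r0) => t tr.
    by split; [exact: normalizer_gt0 ((Hr t).1 tr)|exact: D1].
  have := conjugate_objective_max ((Hr t).1 tr); rewrite /=; lra.
have S2 : W * derive1 (fun g2 : R => q gs.1 g2) gs.2 = b * q gs.1 gs.2.
  rewrite -[b]opprK.
  apply: (@log_stationary R (fun g2 : R => q gs.1 g2) gs.2 r W (- b) r0) => t tr.
    by split; [exact: normalizer_gt0 ((Hr t).2 tr)|exact: D2].
  have := conjugate_objective_max ((Hr t).2 tr); rewrite /=; lra.
have r00 (x : R) : `|x - x| < r by rewrite subrr normr0.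
(* Since [b] and [q] are nonzero, the second stationarity equation forces both [W] and the partial
   derivative in the denominator to be nonzero; in the quotient of the two equations [W] and [q]
   cancel. *)
have Wd2 : W * derive1 (fun g2 : R => q gs.1 g2) gs.2 != 0.
  by rewrite S2 mulf_neq0// gt_eqF.
have [W0 d20] : W != 0 /\ derive1 (fun g2 : R => q gs.1 g2) gs.2 != 0.
  by move: Wd2; rewrite mulf_eq0 negb_or => /andP[].
split => //; [exact: D1|exact: D2|].
move: S1 S2 d20; set d1 := derive1 _ gs.1; set d2 := derive1 _ gs.2 => S1 S2 d20.
have -> : d1 / d2 = (W * d1) / (W * d2) by field; rewrite W0 d20.
by rewrite S1 S2; field; rewrite b0 gt_eqF.
Qed.

End conjugate_family.

(** Three tame selections feed [tame_remainder]: a single fixed candidate, a locally bounded below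
    set of parameters, and the minimizers in [K] when [G] has finite entropy. *)
Theorem theorem3 (R : realType)
  (mu : {sigma_finite_measure set (measurableTypeR R) -> \bar R}) (f0 psi : R -> R)
  (Theta : set R) (theta0 : R)
  (d : measure_display) (Omega : measurableType d)
  (P : R -> probability Omega R) (X : nat -> {mfun Omega >-> R})
  (G : probability (measurableTypeR R) R)
  (f0_meas : measurable_fun [set: measurableTypeR R] f0) (f0_ge0 : forall x, 0 <= f0 x)
  (Theta_open : open Theta) (Theta_itv : is_interval Theta)
  (Theta0 : Theta theta0)
  (iid : iid_expfam mu f0 psi Theta P X)
  (psi_derivable : forall theta, Theta theta ->
     derivable psi theta 1 /\ derivable (derive1 psi) theta 1)
  (psi''_gt0 : forall theta, Theta theta -> 0 < derive1 (derive1 psi) theta)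
  (moment4 : forall theta, Theta theta ->
     (\int[P theta]_w (`|X 0%N w| ^+ 4)%:E < +oo)%E)
  (G_Theta : G Theta = 1%E) (G_ac : G `<< lebesgue_measure) :
  (* optimality *)
  (forall (I : Type) (Gamma : set I) (h : I -> R -> R)
      (H : I -> probability (measurableTypeR R) R) (M : R -> nat),
     mixing_family Theta Gamma h H ->
     (forall alpha, (0 < M alpha)%N) ->
     (fun alpha : R => (M alpha)%:R : R^o) =O_ (at_right (0 : R))
       (fun alpha : R => ln alpha^-1 : R^o) ->
     (* remainder for each candidate gs *)
     (forall gs, Gamma gs ->
        exists2 r : R -> R, r alpha @[alpha --> 0^'+] --> (0 : R) &
          \forall alpha \near 0^'+,
            is_argmin Gamma
              (criterion psi Theta theta0 G h (M alpha) alpha) gs ->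
            forall g, Gamma g ->
              avg_run_length psi Theta theta0 X P G (H gs) (M alpha) alpha
              <= avg_run_length psi Theta theta0 X P G (H g) (M alpha) alpha
                 + r alpha) /\
     (* one remainder for all minimizers gs, which may move with alpha *)
     (forall K : set I, K `<=` Gamma ->
        locally_bounded_below Theta h K \/ finite_entropy G ->
        exists2 r : R -> R, r alpha @[alpha --> 0^'+] --> (0 : R) &
          \forall alpha \near 0^'+, forall gs, K gs ->
            is_argmin Gamma
              (criterion psi Theta theta0 G h (M alpha) alpha) gs ->
            forall g, Gamma g ->
              avg_run_length psi Theta theta0 X P G (H gs) (M alpha) alpha
              <= avg_run_length psi Theta theta0 X P G (H g) (M alpha) alpha
                 + r alpha)) /\
  (* conjugate case *)
  (forall (Gamma : set (R * R)) (q : R -> R -> R)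
      (H : R * R -> probability (measurableTypeR R) R) (M : nat) (alpha : R) (gs : R * R),
     mixing_family Theta Gamma (conjugate_density psi q) H ->
     (0 < M)%N -> 0 < alpha < 1 ->
     is_argmin Gamma
       (criterion psi Theta theta0 G (conjugate_density psi q) M alpha) gs ->
     interior Gamma gs ->
     let wt := weight psi Theta theta0 M alpha in
     G.-integrable Theta (fun theta => (wt theta * theta)%:E) ->
     G.-integrable Theta (fun theta => (wt theta * psi theta)%:E) ->
     Rintegral G Theta (fun theta => wt theta * psi theta) != 0 ->
     [/\ derivable (fun g1 : R => q g1 gs.2) gs.1 1,
         derivable (fun g2 : R => q gs.1 g2) gs.2 1,
         derive1 (fun g2 : R => q gs.1 g2) gs.2 != 0 &
         derive1 (fun g1 : R => q g1 gs.2) gs.1 /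
         derive1 (fun g2 : R => q gs.1 g2) gs.2 =
         - (Rintegral G Theta (fun theta => wt theta * theta) /
            Rintegral G Theta (fun theta => wt theta * psi theta))]).
Proof.
split; last first.
  move=> Gamma q H M alpha gs mixH M0 alpha01 amin gsint wt It Ip b0.
  exact: (conjugate_stationary Theta_open Theta0 psi_derivable mixH M0
    alpha01 amin gsint It Ip b0).
move=> I Gamma h H M mixH M0 /eqOP MO.
have [C C0 MC] : exists2 C : R, 0 < C &
    \forall alpha \near 0^'+, (M alpha)%:R <= C * ln alpha^-1.
  have [C [C0 HC]] := filter_ex (filterI (nbhs_pinfty_gt (num_real (0 : R))) MO).
  exists C => //; near=> alpha.
  have [a0 L0] : 0 < alpha /\ 0 <= ln alpha^-1 by near: alpha; exact: near_ln_inv.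
  have : `|(M alpha)%:R : R^o| <= C * `|ln alpha^-1 : R^o| by near: alpha.
  by rewrite !ger0_norm.
have remainder := tame_remainder f0_meas f0_ge0 Theta_open Theta_itv Theta0 iid
  psi_derivable G_Theta G_ac mixH M0 C0 MC.
split.
  move=> gs Ggs.
  have sub : [set gs] `<=` Gamma by move=> _ ->.
  have [r r0 Hr] := remainder _ (fun _ => sub)
    (tame_locally_bounded psi theta0 G M sub (locally_bounded_below1 mixH Ggs)).
  by exists r => //; apply: nearW => alpha _ g _; exact: Hr.
move=> K KG [lb|ent].
  have [r r0 Hr] := remainder _ (fun _ => KG) (tame_locally_bounded psi theta0 G M KG lb).
  by exists r => //; apply: nearW => alpha gs Kgs _ g _; exact: Hr.
have tS := finite_entropy_tame Theta_open Theta_itv Theta0 psi_derivable psi''_gt0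
  G_Theta mixH KG M0 C0 MC ent.
have [|r r0 Hr] := remainder _ _ tS; first by move=> alpha gs [/KG].
by exists r => //; apply: nearW => alpha gs Kgs amin g _; exact: Hr.
Unshelve. all: end_near. Qed.
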